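(* For integers $k\ge 2$, $r\ge 2$ and every $\varepsilon>0$, there exists $\eta>0$ such that the following holds. Suppose $H$ is an $n$-vertex $k$-graph with at least $\varepsilon n^k$ edges and $p=p(n)\ge n^{-\binom{k+r-2}{k-1}^{-1}-\eta}$. Then with high probability $H\cup G^{(k)}(n,p)$ contains the $r$-th power of a tight Hamilton cycle.
   Context: A $k$-graph is a hypergraph whose edges are $k$-element subsets of the vertex set. $G^{(k)}(n,p)$ is the binomial random $k$-graph on the vertex set of $H$, in which each $k$-subset is an edge independently with probability $p$; $H\cup G^{(k)}(n,p)$ has as edge set the union of the two edge sets. The $r$-th power of a tight cycle is a $k$-graph whose vertices can be ordered cyclically such that every $k+r-1$ cyclically consecutive vertices span a complete $k$-graph $K^{(k)}_{k+r-1}$, and there are no other edges. The $r$-th power of a tight Hamilton cycle in $H\cup G^{(k)}(n,p)$ means a spanning subgraph isomorphic to the $r$-th power of a tight cycle on $n$ vertices. ''With high probability'' means with probability tending to $1$ as $n\to\infty$. *)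

(* Defs.v *)
From HB Require Import structures.
From mathcomp Require Import all_boot all_order all_algebra.
From mathcomp Require Import all_classical all_reals all_analysis.

Set Implicit Arguments.
Unset Strict Implicit.
Unset Printing Implicit Defensive.

Import Order.TTheory GRing.Theory Num.Theory.
Import numFieldNormedType.Exports.

Local Open Scope ring_scope.

(* A hypergraph on the finite vertex type V is given by its set of edges. *)
Definition is_kgraph (V : finType) (k : nat) (E : {set {set V}}) : bool :=
  [forall e in E, #|e| == k].

(* The l cyclically consecutive positions i, i + 1, ..., i + l - 1 modulo m. *)
Definition cyc_window (m l : nat) (i : 'I_m) : {set 'I_m} :=
  [set x : 'I_m | [exists j : 'I_l, nat_of_ord x == ((i + j) %% m)%N]].

(* F, as a k-graph with vertex set all of V, is the r-th power of a tight
   cycle. The cyclic ordering of V is the bijection f (an injection between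
   types of the same cardinality). *)
Definition is_tight_cycle_power (V : finType) (k r : nat)
    (F : {set {set V}}) : bool :=
  [exists f : {ffun 'I_#|V| -> V}, injectiveb f &&
    (F == [set e : {set V} | (#|e| == k) &&
             [exists i : 'I_#|V|, e \subset f @: cyc_window (k + r - 1) i]])].

Definition has_tight_ham_cycle_power (V : finType) (k r : nat)
    (E : {set {set V}}) : bool :=
  [exists F : {set {set V}}, is_tight_cycle_power k r F && (F \subset E)].

(* The probability that the binomial random k-graph on V with edge probability
   p equals the k-graph G. *)
Definition Gkp_weight (R : realType) (V : finType) (k : nat) (p : R)
    (G : {set {set V}}) : R :=
  \prod_(e : {set V} | #|e| == k) (if e \in G then p else 1 - p).

Definition Gkp_prob (R : realType) (V : finType) (k : nat) (p : R)
    (A : pred {set {set V}}) : R :=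
  \sum_(G : {set {set V}} | is_kgraph k G && A G) Gkp_weight k p G.

(* Main.v *)
Require Import Defs.
From HB Require Import structures.
From mathcomp Require Import all_boot all_order all_fingroup all_algebra.
From mathcomp Require Import all_classical all_reals all_analysis.
From mathcomp Require Import fintype finset zify ring lra.

(* Fix k consecutive positions ("blocks") out of every L = O(1) positions of
   the cyclic order, and consider the orderings that map every block to an edge
   of H.  Each of these needs, besides H, only the edges of the power of the
   tight cycle other than the blocks, and a uniformly random such ordering
   agrees with a prescribed one on a set A of positions with probability at most
   (C/n)^|A|.  A subgraph Q of the position graph without block edges has at
   most (d - c)(v(Q) - comp(Q)) edges, where d = 'C(k + r - 2, k - 1): every
   vertex is the last vertex of at most d edges, r >= 2 makes every component
   lose something at its start, and the missing blocks make long components lose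
   a positive fraction.  Hence the family of needed edge sets is q-spread with
   q = O(n^(-1/(d - c))), polynomially smaller than p.  The minimum-fragment
   argument of Park and Pham for spread families then needs only boundedly many
   rounds of exposure, because each round shrinks the fragments by a power of n. *)

Set Implicit Arguments.
Unset Strict Implicit.
Unset Printing Implicit Defensive.

Import Order.TTheory GRing.Theory Num.Theory.
Import numFieldNormedType.Exports.

Local Open Scope ring_scope.

(** * Percolation measure and fragments *)

(** The exponent [1/d] is the first-moment barrier: a new vertex of the order has about [n] choices
    and completes up to [d] edges. Long stretches of the full power come arbitrarily close to [d]
    edges per vertex. Giving [H] one edge in boundedly many positions lowers the ratio to [d - 1/M],
    where [M] is [m] times the largest gap between blocks, up to [k], and [m = k + r - 1]; the gap
    between [1/d] and [1/(d - 1/M)] is the source of [eta]. Components enter the count as rooted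
    trees. A root of a tree may sit at any of [n] positions, while every other vertex lies within
    [m] of its parent, so only the non-roots gain a factor [1/n] each. Counting by last vertices
    needs a linear order, but the positions form a cycle. A set [Q] of position edges is therefore
    read from a cut that none of its edges crosses. If every cut is crossed, [Q] has at least [n/m]
    edges; the boundedly many edges across one cut are then discarded, and the loss, polynomial in
    [n], is paid by the [2 ^ |Q|] that comes from doubling the spread constant. *)

Section Percolation.
Variables (R : realType) (X : finType) (D : {set X}).

(** A measure on all subsets of [X], zero unless [W] lies in [D]: sums then range over every [W],
    and products distribute over the elements of [X]. *)
Definition perc_weight (p : R) (W : {set X}) : R :=
  \prod_e (if e \in W then (if e \in D then p else 0)
           else (if e \in D then 1 - p else 1)).

Lemma perc_weight_ge0 p W : 0 <= p <= 1 -> 0 <= perc_weight p W.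
Proof.
move=> /andP[p0 p1]; apply: prodr_ge0 => e _.
by case: ifP => _; case: ifP => _ //; rewrite subr_ge0.
Qed.

Lemma sum_perc_weight p : \sum_W perc_weight p W = 1.
Proof.
rewrite -[RHS](_ : \prod_(e : X) ((if e \in D then p else 0) +
   (if e \in D then 1 - p else 1)) = 1); last first.
  by apply: big1 => e _; case: ifP => _; [rewrite addrC subrK | rewrite add0r].
by rewrite bigA_distr; apply: eq_bigr.
Qed.

Lemma sum_subset_expr (U : {set X}) (y : R) :
  \sum_(T : {set X} | T \subset U) y ^+ #|T| = (1 + y) ^+ #|U|.
Proof.
rewrite (_ : _ ^+ #|U| = \prod_(e : X) ((if e \in U then y else 0) + 1)).
  rewrite bigA_distr /= [RHS](bigID (fun T : {set X} => T \subset U)) /=.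
  rewrite [X in _ = _ + X]big1 ?addr0 => [|T /subsetPn[e eT eU]].
    apply: eq_bigr => T TU; rewrite -big_mkcond /= -prodr_const.
    by apply: eq_bigr => e eT; rewrite (subsetP TU).
  by rewrite (bigD1 e) //= eT (negPf eU) mul0r.
rewrite (bigID (mem U)) /= [X in _ = _ * X]big1 ?mulr1.
  by rewrite -prodr_const; apply: eq_bigr => e eU; rewrite ifT // addrC.
by move=> e /negPf eU; rewrite ifF // add0r.
Qed.

(** Elements behave independently. For fixed [W1] the sum over [W2] factors over [e], with [F2] for
    [e] in [W2] and [G2] for [e] outside; both vanish where the union would disagree with [W]. *)
Lemma perc_weight_union p1 p2 (W : {set X}) :
  \sum_(W1 : {set X}) \sum_(W2 : {set X} | W1 :|: W2 == W)
     perc_weight p1 W1 * perc_weight p2 W2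
  = perc_weight (1 - (1 - p1) * (1 - p2)) W.
Proof.
pose u p e := if e \in D then p else 0 : R.
pose v p e := if e \in D then 1 - p else 1 : R.
pose F2 (W1 : {set X}) e := if e \in W then
  (if e \in W1 then u p1 e else v p1 e) * u p2 e else 0.
pose G2 (W1 : {set X}) e := if e \in W then
  (if e \in W1 then u p1 e * v p2 e else 0)
  else (if e \in W1 then 0 else v p1 e * v p2 e).
transitivity (\sum_(W1 : {set X}) \prod_e (F2 W1 e + G2 W1 e)).
  apply: eq_bigr => W1 _; rewrite bigA_distr /= big_mkcond /=.
  apply: eq_bigr => W2 _; case: eqP => [WE|neq].
    rewrite -big_split /=; apply: eq_bigr => e _.
    by rewrite /F2 /G2 -WE /u /v !inE; case: (e \in W1); case: (e \in W2).
  have [e eP] : exists e, (e \in W1 :|: W2) != (e \in W).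
    apply/existsP; rewrite -negb_forall; apply/negP => /forallP h.
    by apply: neq; apply/setP => e; apply/eqP; exact: h.
  rewrite (bigD1 e) //= /F2 /G2; move: eP; rewrite !inE.
  by case: (e \in W1); case: (e \in W2); case: (e \in W) => //= _; rewrite mul0r.
pose F1 e := if e \in W then u p1 e * (u p2 e + v p2 e) else 0.
pose G1 e := if e \in W then v p1 e * u p2 e else v p1 e * v p2 e.
transitivity (\prod_e (F1 e + G1 e)).
  rewrite bigA_distr /=; apply: eq_bigr => W1 _; apply: eq_bigr => e _.
  rewrite /F2 /G2 /F1 /G1; case: (e \in W); case: (e \in W1);
    rewrite ?addr0 ?add0r //; ring.
apply: eq_bigr => e _; rewrite /F1 /G1 /u /v; case: (e \in W); case: (e \in D);
  ring.
Qed.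

Lemma sum_perc_weight_union p1 p2 (h : {set X} -> R) :
  \sum_(W1 : {set X}) perc_weight p1 W1 *
     (\sum_(W2 : {set X}) perc_weight p2 W2 * h (W1 :|: W2))
  = \sum_W perc_weight (1 - (1 - p1) * (1 - p2)) W * h W.
Proof.
transitivity (\sum_(W : {set X}) \sum_(W1 : {set X})
   \sum_(W2 : {set X} | W1 :|: W2 == W) perc_weight p1 W1 * perc_weight p2 W2 * h W).
  rewrite exchange_big /=; apply: eq_bigr => W1 _.
  rewrite big_distrr /= (partition_big (fun W2 => W1 :|: W2) predT) //=.
  apply: eq_bigr => W _; apply: eq_bigr => W2 /eqP <-.
  by rewrite mulrA.
apply: eq_bigr => W _; rewrite -perc_weight_union big_distrl /=.
by apply: eq_bigr => W1 _; rewrite big_distrl.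
Qed.

Lemma perc_weight_setD p (Z T : {set X}) : 0 <= p <= 1 ->
  T \subset Z -> T \subset D ->
  perc_weight p (Z :\: T) * p ^+ #|T| <= perc_weight p Z.
Proof.
move=> /andP[p0 p1] TZ TD.
have -> : p ^+ #|T| = \prod_e (if e \in T then p else 1).
  by rewrite -big_mkcond /= prodr_const.
rewrite -big_split /=; apply: ler_prod => e _; rewrite !inE.
case: (boolP (e \in T)) => eT /=.
  rewrite (subsetP TZ) // (subsetP TD) // mulr_ge0 ?subr_ge0 //=.
  by rewrite ler_piMl // gerBl.
rewrite mulr1 lexx andbT.
by case: ifP => _; case: ifP => _ //; rewrite subr_ge0.
Qed.

End Percolation.

Lemma ler_sum_inj (R : numDomainType) (A B : finType) (h : A -> B) (G : B -> R) :
  injective h -> (forall y, 0 <= G y) -> \sum_x G (h x) <= \sum_y G y.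
Proof.
move=> hinj G0; rewrite -(big_imset G (in2W hinj)) /=.
rewrite [X in _ <= X](bigID (mem (h @: xpredT))) /= lerDl.
by apply: sumr_ge0.
Qed.

Section Fragments.
Variables (R : realType) (X I : finType) (D : {set X}).
Variables (T : I -> {set X}) (Om : {set I}).

(* The minimum fragment of Park and Pham: what is left to be covered by later
   rounds once W has been exposed, for the member of the family contained in
   W :|: T i that needs the fewest new elements. *)
Definition fragment (W : {set X}) (i : I) : {set X} :=
  T [arg min_(j < i | (j \in Om) && (T j \subset W :|: T i)) #|T j :\: W|] :\: W.

Lemma fragmentP W i : i \in Om -> exists2 j, j \in Om &
  [/\ T j \subset W :|: T i, fragment W i = T j :\: W &
   forall j', j' \in Om -> T j' \subset W :|: T i ->
     (#|fragment W i| <= #|T j' :\: W|)%N].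
Proof.
move=> iO; rewrite /fragment; case: arg_minnP => [|j /andP[jO jW] jmin].
  by rewrite iO subsetUr.
by exists j => //; split=> // j' j'O j'W; have := jmin j'; rewrite j'O j'W => ->.
Qed.

Lemma fragment_sub W i : i \in Om -> fragment W i \subset T i.
Proof. by move=> /(fragmentP W)[j jO [jW -> _]]; rewrite subDset. Qed.

Lemma fragment_cover W i : i \in Om ->
  exists2 j, j \in Om & T j \subset W :|: fragment W i.
Proof.
move=> /(fragmentP W)[j jO [jW -> _]]; exists j => //.
by rewrite -subDset.
Qed.

(** As [fragment W i] lies in [T i], the index [j] competes in the minimisation; [T j :\: W] is
    inside the fragment and not smaller, so the two coincide. Thus the fragment lies in every member
    contained in [W :|: fragment W i], and such a member can be chosen knowing the union only. *)
Lemma fragment_subset W i j : i \in Om -> j \in Om ->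
  T j \subset W :|: fragment W i -> fragment W i \subset T j.
Proof.
move=> iO jO jW; have fi := fragment_sub W iO.
have [_ _ [_ _ minf]] := fragmentP W iO.
have jf : T j :\: W \subset fragment W i by rewrite subDset.
have /eqP <- : T j :\: W == fragment W i.
  rewrite eqEcard jf minf //; apply: (subset_trans jW).
  by rewrite setUS.
exact: subsetDl.
Qed.

(** [W] is recovered from the pair of [Z = W :|: fragment W i] and [S = fragment W i]. Passing to
    [Z] costs [p] to the power [- #|S|], but [S] is now a subset of a member determined by [Z], and
    spread bounds the number of [i] with [S] inside [T i]. What remains is a binomial sum over the
    subsets of that member. *)
Lemma fragment_moment (p q z b M : R) :
  0 < p <= 1 -> 0 <= q -> 0 <= z -> 0 <= b -> 0 <= M ->
  (forall i, i \in Om -> T i \subset D) ->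
  (forall i, i \in Om -> #|T i|%:R <= b) ->
  (forall S : {set X}, #|[set i in Om | S \subset T i]|%:R <= q ^+ #|S| * M) ->
  \sum_(i in Om) \sum_(W : {set X}) perc_weight D p W * z ^+ #|fragment W i|
    <= M * expR (z * q / p * b).
Proof.
move=> /andP[p0 p1] q0 z0 b0 M0 TD Tb spr.
have p01 : 0 <= p <= 1 by rewrite (ltW p0).
(* For [Z = W :|: fragment W i] the pick succeeds, by [fragment_cover]. *)
pose U (Z : {set X}) := if [pick j | (j \in Om) && (T j \subset Z)] is Some j then T j else set0.
have Ub Z : #|U Z|%:R <= b.
  by rewrite /U; case: pickP => [j /andP[jO _]|_]; [exact: Tb | rewrite cards0].
pose G i (ZS : {set X} * {set X}) : R := if (ZS.2 \subset U ZS.1) && (ZS.2 \subset T i)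
   then perc_weight D p ZS.1 * (z / p) ^+ #|ZS.2| else 0.
have zp0 : 0 <= z / p by rewrite divr_ge0 // ltW.
have G0 i ZS : 0 <= G i ZS.
  by rewrite /G; case: ifP => // _; rewrite mulr_ge0 ?perc_weight_ge0 ?exprn_ge0.
apply: (@le_trans _ _ (\sum_(i in Om) \sum_ZS G i ZS)).
  apply: ler_sum => i iO.
  pose h W := (W :|: fragment W i, fragment W i).
  have hinj : injective h.
    move=> W1 W2 [].
    have hW W : W = (W :|: fragment W i) :\: fragment W i.
      rewrite setDUl setDv setU0; apply/esym/setDidPl.
      rewrite -setI_eq0; have [j jO [_ -> _]] := fragmentP W iO.
      by rewrite setIDA setIC setDIl setDv setI0.
    by move=> e1 e2; rewrite (hW W1) (hW W2) e1 e2.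
  apply: le_trans (ler_sum_inj hinj (G0 i)).
  apply: ler_sum => W _; rewrite /G /h /= fragment_sub // andbT.
  have -> : fragment W i \subset U (W :|: fragment W i).
    rewrite /U; case: pickP => [j /andP[jO jW]|no]; first exact: fragment_subset.
    by have [j jO jW] := fragment_cover W iO; have := no j; rewrite jO jW.
  set f := fragment W i.
  have fD : f \subset D by apply: subset_trans (TD i iO); exact: fragment_sub.
  have := perc_weight_setD p01 (subsetUr W f) fD.
  have -> : (W :|: f) :\: f = W.
    rewrite setDUl setDv setU0; apply/setDidPl; rewrite -setI_eq0.
    have [j jO [_ -> _]] := fragmentP W iO.
    by rewrite setIDA setIC setDIl setDv setI0.
  rewrite expr_div_n mulrA -ler_pdivlMr ?exprn_gt0 // => hh.
  rewrite mulrAC; apply: ler_wpM2r => //; exact: exprn_ge0.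
apply: (@le_trans _ _ (\sum_(Z : {set X}) perc_weight D p Z *
    (\sum_(S : {set X} | S \subset U Z) (z / p) ^+ #|S| * (q ^+ #|S| * M)))).
  rewrite exchange_big /= -(pair_bigA _ (fun Z S => \sum_(i in Om) G i (Z, S))) /=.
  apply: ler_sum => Z _; rewrite big_distrr /= [X in _ <= X]big_mkcond /=.
  apply: ler_sum => S _; rewrite /G /=; case: ifP => SU /=; last by rewrite big1.
  rewrite -big_mkcondr /= sumr_const mulrA -mulr_natr.
  rewrite ler_wpM2l ?mulr_ge0 ?perc_weight_ge0 ?exprn_ge0 //.
  apply: le_trans (spr S); rewrite ler_nat.
  by apply: subset_leq_card; apply/subsetP => i; rewrite !inE.
have -> : M * expR (z * q / p * b) =
   \sum_(Z : {set X}) perc_weight D p Z * (M * expR (z * q / p * b)).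
  by rewrite -big_distrl /= sum_perc_weight mul1r.
apply: ler_sum => Z _; apply: ler_wpM2l; first exact: perc_weight_ge0.
under eq_bigr => S _ do rewrite mulrA -exprMn.
rewrite -big_distrl /= sum_subset_expr mulrC; apply: ler_wpM2l => //.
have -> : z / p * q = z * q / p by rewrite mulrAC.
have y0 : 0 <= z * q / p by rewrite divr_ge0 ?mulr_ge0 // ltW.
apply: (@le_trans _ _ (expR (z * q / p) ^+ #|U Z|)).
  by apply: lerXn2r; rewrite ?nnegrE ?expR_ge0 ?addr_ge0 ?expR_ge1Dx.
rewrite -expRM_natl ler_expR mulrC; apply: ler_wpM2l => //.
Qed.

End Fragments.

(** Each round exposes density [p'], replaces members by fragments and keeps those of size at most
    [th * b]. The kept family may be small, so failure is weighted by [#|Om|] while [M] stays fixed: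
    fragments are subsets of the old members and inherit the bound with the same [q] and [M]. A
    round drops at most [err * M] indices on average, and once [b < 1] every member is empty and
    hence covered. *)
Lemma spread_cover_fail (R : realType) (X I : finType) (D : {set X})
    (p' th q M : R) (J : nat) (T : I -> {set X}) (Om : {set I}) (b p : R) :
  0 < p' < 1 -> 0 < th -> 0 < q -> expR 1 * q <= th * p' -> 0 <= M ->
  0 <= b -> th ^+ J * b < 1 -> 0 <= p <= 1 -> 1 - p <= (1 - p') ^+ J ->
  (forall i, i \in Om -> T i \subset D) ->
  (forall i, i \in Om -> #|T i|%:R <= b) ->
  (forall S : {set X}, #|[set i in Om | S \subset T i]|%:R <= q ^+ #|S| * M) ->
  #|Om|%:R * (\sum_(W : {set X}) perc_weight D p W *
     (~~ [exists i in Om, T i \subset W])%:R)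
    <= J%:R * (expR 1 * q / (th * p')) * M.
Proof.
move=> /andP[p'0 p'1] th0 q0 hq M0.
elim: J T Om b p => [|J IH] T Om b p b0 hb /andP[p0 p1] hp TD Tb spr.
  rewrite !mul0r; have [->|[i iO]] := set_0Vmem Om; first by rewrite cards0 mul0r.
  rewrite big1 ?mulr0 // => W _.
  have T0 : T i = set0.
    apply/eqP; rewrite -cards_eq0 -leqn0 -ltnS -(ltr_nat R).
    by apply: le_lt_trans (Tb i iO) _; rewrite expr0 mul1r in hb.
  case: existsP => [|[]]; first by rewrite mulr0.
  by exists i; rewrite iO T0 sub0set.
(* Makes [z * q / p' = th], so that the moment is at most [M * expR (th * b)]; the hypothesis on [q]
   says [z >= expR 1]. *)
pose z := th * p' / q.
have z0 : 0 < z by rewrite divr_gt0 // mulr_gt0.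
have ze : expR 1 <= z by rewrite ler_pdivlMr.
pose err := expR 1 * q / (th * p').
have errE : err = expR 1 / z by rewrite /err /z invf_div mulrA.
have err0 : 0 <= err by rewrite errE divr_ge0 ?expR_ge0 // ltW.
(* The density left for later rounds: independent exposures of densities [p'] and [p2] together have
   density [p]. *)
pose p2 := 1 - (1 - p) / (1 - p').
have p'1' : 0 < 1 - p' by rewrite subr_gt0.
have pE : p = 1 - (1 - p') * (1 - p2).
  by rewrite /p2; field; rewrite gt_eqF.
have p2E : 1 - p2 = (1 - p) / (1 - p') by rewrite /p2; ring.
have hp2 : 1 - p2 <= (1 - p') ^+ J.
  by rewrite p2E ler_pdivrMr // mulrC -exprS.
have p201 : 0 <= p2 <= 1.
  apply/andP; split; last first.
    by rewrite /p2 gerBl divr_ge0 ?subr_ge0 // ltW.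
  have : 1 - p2 <= 1.
    apply: (le_trans hp2); apply: exprn_ile1; first exact: ltW.
    by rewrite gerBl ltW.
  by lra.
pose fl (W : {set X}) : R := (~~ [exists i in Om, T i \subset W])%:R.
pose Om1 W := [set i in Om | #|fragment T Om W i|%:R <= th * b].
rewrite pE -(sum_perc_weight_union D p' p2 fl) big_distrr /=.
have step (W : {set X}) : #|Om|%:R * (perc_weight D p' W *
    (\sum_(W2 : {set X}) perc_weight D p2 W2 * fl (W :|: W2)))
  <= perc_weight D p' W * (#|Om :\: Om1 W|%:R + J%:R * err * M).
  rewrite mulrCA; apply: ler_wpM2l.
    by apply: perc_weight_ge0; rewrite !ltW.
  rewrite -(cardsID (Om1 W) Om) natrD mulrDl addrC; apply: lerD.
    rewrite ler_piMr //; apply: (@le_trans _ _ (\sum_(W2 : {set X}) perc_weight D p2 W2)).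
      apply: ler_sum => W2 _; rewrite ler_piMr ?perc_weight_ge0 // /fl.
      by case: (~~ _).
    by rewrite sum_perc_weight.
  have OmE : Om :&: Om1 W = Om1 W.
    by apply/setIidPr/subsetP => i; rewrite inE => /andP[].
  rewrite OmE.
  apply: (@le_trans _ _ (#|Om1 W|%:R * (\sum_(W2 : {set X}) perc_weight D p2 W2 *
     (~~ [exists i in Om1 W, fragment T Om W i \subset W2])%:R))).
    apply: ler_wpM2l => //; apply: ler_sum => W2 _.
    apply: ler_wpM2l; first exact: perc_weight_ge0.
    rewrite /fl; case: (boolP [exists i in Om1 W, _]) => [|_]; last first.
      by rewrite ler_nat; case: (~~ _).
    move=> /existsP[i /andP[]].
    rewrite inE => /andP[iO _] fW2; case: existsP => // -[].
    have [j jO jW] := fragment_cover T W iO; exists j; rewrite jO.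
    by apply: subset_trans jW _; rewrite setUS.
  apply: (IH _ _ (th * b)) => //.
  - by rewrite mulr_ge0 // ltW.
  - by rewrite mulrA -exprSr.
  - move=> i; rewrite inE => /andP[iO _]; apply: subset_trans (TD i iO).
    exact: fragment_sub.
  - by move=> i; rewrite inE => /andP[].
  - move=> S; apply: le_trans (spr S); rewrite ler_nat; apply: subset_leq_card.
    apply/subsetP => i; rewrite !inE => /andP[/andP[iO _] Sf]; rewrite iO.
    by apply: subset_trans Sf _; exact: fragment_sub.
apply: (le_trans (ler_sum _ (fun W _ => step W))).
under eq_bigr => W _ do rewrite mulrDr.
rewrite big_split /= -[X in _ + X]big_distrl /= sum_perc_weight mul1r.
rewrite -/err -natr1 mulrDl mul1r mulrDl addrC lerD2l.
(* Markov's inequality: a fragment of size [t > th * b] has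
   [c * z ^+ t >= expR (t - th * b) >= 1]. *)
pose c := err * expR (- (th * b)).
have c0 : 0 <= c by rewrite mulr_ge0 // expR_ge0.
apply: (@le_trans _ _ (c * (\sum_(i in Om) \sum_(W : {set X})
    perc_weight D p' W * z ^+ #|fragment T Om W i|))).
  rewrite exchange_big /= big_distrr /=; apply: ler_sum => W _.
  rewrite -big_distrr /= mulrCA; apply: ler_wpM2l.
    by apply: perc_weight_ge0; rewrite !ltW.
  rewrite big_distrr /= -sum1_card natr_sum.
  rewrite [X in X <= _](_ : _ = \sum_(i in Om) (if i \notin Om1 W then 1 else 0)); last first.
    rewrite -big_mkcondr /=; apply: eq_bigl => i; rewrite !inE andbC.
    by case: (i \in Om).
  apply: ler_sum => i iO; case: ifP => [|_]; last first.
    by rewrite mulr_ge0 ?exprn_ge0 // ltW.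
  rewrite inE iO /= -ltNge; set t := #|_| => ht.
  have t0 : (0 < t)%N.
    by rewrite -(ltr_nat R); apply: le_lt_trans ht; rewrite mulr_ge0 // ltW.
  rewrite /c errE -(prednK t0) exprS.
  have -> : expR 1 / z * expR (- (th * b)) * (z * z ^+ t.-1)
    = expR 1 * expR (- (th * b)) * z ^+ t.-1 by field; rewrite gt_eqF.
  apply: (@le_trans _ _ (expR 1 * expR (- (th * b)) * expR 1 ^+ t.-1)).
    rewrite -expRM_natl mulr1 -!expRD -[X in X <= _]expR0 ler_expR.
    have : t.-1%:R + 1 = t%:R :> R by rewrite natr1 prednK.
    by lra.
  apply: ler_wpM2l; first by rewrite mulr_ge0 ?expR_ge0.
  by apply: lerXn2r; rewrite ?nnegrE ?expR_ge0 // ltW.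
apply: (@le_trans _ _ (c * (M * expR (z * q / p' * b)))).
  apply: ler_wpM2l => //; apply: fragment_moment => //; try exact: ltW.
  by rewrite p'0 ltW.
have -> : z * q / p' = th by rewrite /z; field; rewrite !gt_eqF.
by rewrite /c mulrACA -expRD addNr expR0 mulr1.
Qed.

(** * Forests in linear position graphs *)

Lemma double_count (A B : finType) (S : {set A}) (T : {set B}) (r : A -> B -> bool) :
  (\sum_(a in S) #|[set b in T | r a b]| = \sum_(b in T) #|[set a in S | r a b]|)%N.
Proof.
have eA a : #|[set b in T | r a b]| = (\sum_(b in T) r a b)%N.
  rewrite -sum1_card big_mkcond [RHS]big_mkcond; apply: eq_bigr => b _.
  by rewrite inE; case: (b \in T); case: (r a b).
have eB b : #|[set a in S | r a b]| = (\sum_(a in S) r a b)%N.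
  rewrite -sum1_card big_mkcond [RHS]big_mkcond; apply: eq_bigr => a _.
  by rewrite inE; case: (a \in S); case: (r a b).
by under eq_bigr do rewrite eA; under [RHS]eq_bigr do rewrite eB; rewrite exchange_big.
Qed.

Section Forest.
Local Open Scope nat_scope.
Variables (P : finType) (rho : P -> nat) (k m L : nat) (Q : {set {set P}}).
Hypothesis rho_inj : injective rho.
Hypothesis rho_pred : forall a, 0 < rho a -> exists a', (rho a').+1 = rho a.
Hypothesis k_ge2 : 2 <= k.
Hypothesis k_lt_m : k < m.
Hypothesis Qk : forall e, e \in Q -> #|e| = k.
Hypothesis Qspan : forall e u v, e \in Q -> u \in e -> v \in e -> rho u < rho v + m.
(** The blocks enter here: [c] is the last vertex of a missing edge [e], so fewer than [d] edges of
    [Q] end at [c]. *)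
Hypothesis blocks : forall a, L <= (rho a).+1 -> exists e c,
  [/\ e \notin Q, #|e| = k, c \in e, rho c <= rho a < rho c + L &
   forall u, u \in e -> rho u <= rho c < rho u + m].

Let d := 'C(m - 1, k - 1).
Let mx (e : {set P}) := \max_(u in e) rho u.
Let Qa a := [set e in Q | (a \in e) && (mx e == rho a)].
Let A := cover Q.
Let tops := [set a | Qa a != set0].
(* If the edges are revealed in the order of their last vertices, then [tau v]
   is the time at which the vertex v appears. *)
Let tau v := if [pick e | (e \in Q) && (v \in e)] is Some e0
  then mx [arg min_(e < e0 | (e \in Q) && (v \in e)) mx e] else 0.
(** The edges ending at [a] meet no vertex that appeared earlier, so [a] has to start a new tree. *)
Let late a := [forall v, (tau v < rho a) ==> ~~ [exists e in Qa a, v \in e]].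
Let roots := [set a in tops | late a].
(** Doubling leaves room for a tie-break: among vertices appearing together, the last one comes
    first and serves as parent of the others. *)
Let rk v := (tau v).*2 + (v \notin tops).
Let grp a := [set v in A | tau v == rho a].
(** The excluded case is the one in which [d] edges per new vertex is attained exactly; every other
    top saves at least one edge. *)
Let good a := ~~ [&& #|Qa a| == d, ~~ late a & #|grp a| == 1].

Lemma card_rho_itv (S : {set P}) x l :
  (forall v, v \in S -> x <= rho v < x + l) -> #|S| <= l.
Proof.
move=> hS; rewrite -(size_iota x l) cardE -(size_map rho).
apply: uniq_leq_size; first by rewrite map_inj_uniq ?enum_uniq.
by move=> y /mapP[v]; rewrite mem_enum => /hS hv ->; rewrite mem_iota.
Qed.

Let le_mx (e : {set P}) u : u \in e -> rho u <= mx e.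
Proof. by move=> ue; exact: leq_bigmax_cond. Qed.

Let mx_mem e : e \in Q -> exists2 a, a \in e & rho a = mx e.
Proof.
move=> eQ; have : 0 < #|e| by rewrite Qk // ltnW.
move=> h; have [a ae ra] := eq_bigmax_cond rho h.
by exists a => //; rewrite /mx ra.
Qed.

Let tau_le v e : e \in Q -> v \in e -> tau v <= mx e.
Proof.
move=> eQ ve; rewrite /tau; case: pickP => [e0 he0|/(_ e)]; last by rewrite eQ ve.
by case: arg_minnP => // e1 _; apply; rewrite eQ ve.
Qed.

Let tau_ex v : v \in A -> exists e, [/\ e \in Q, v \in e & mx e = tau v].
Proof.
move=> /bigcupP[e eQ ve]; rewrite /tau; case: pickP => [e0 he0|/(_ e)].
  by case: arg_minnP => // e1 /andP[e1Q ve1] _; exists e1.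
by rewrite eQ ve.
Qed.

Let tau_ge v : v \in A -> rho v <= tau v.
Proof. by move=> /tau_ex[e [eQ ve <-]]; exact: le_mx. Qed.

Let in_A v e : e \in Q -> v \in e -> v \in A.
Proof. by move=> eQ ve; apply/bigcupP; exists e. Qed.

Let topsP a : reflect (exists e, [/\ e \in Q, a \in e & mx e = rho a]) (a \in tops).
Proof.
rewrite inE; apply: (iffP (set0Pn _)) => [[e]|[e [eQ ae me]]].
  by rewrite inE => /and3P[eQ ae /eqP me]; exists e.
by exists e; rewrite inE eQ ae me eqxx.
Qed.

Let tops_tau a : a \in tops -> tau a = rho a.
Proof.
move=> /topsP[e [eQ ae me]]; apply/eqP; rewrite eqn_leq -{1}me tau_le //.
by rewrite tau_ge // (in_A eQ).
Qed.

Let tau_tops a : a \in A -> tau a = rho a -> a \in tops.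
Proof. by move=> /tau_ex[e [eQ ae me]] h; apply/topsP; exists e; rewrite me h. Qed.

Let tops_A a : a \in tops -> a \in A.
Proof. by move=> /topsP[e [eQ ae _]]; exact: in_A ae. Qed.

(** A vertex that is not a top goes to the last vertex of the edge that revealed it; a top that is
    not late goes to an earlier vertex of one of its edges. *)
Let parent v : v \in A -> v \notin roots ->
  exists2 u, u \in A & rk u < rk v /\ exists2 e, e \in Q & (v \in e) && (u \in e).
Proof.
move=> vA; rewrite inE; case: (boolP (v \in tops)) => [vt|vt _] /=.
  rewrite negb_forall => /existsP[u]; rewrite negb_imply negbK => /andP[ut].
  move=> /existsP[e /andP[]]; rewrite inE => /and3P[eQ ve _] ue.
  exists u; first exact: in_A ue.
  split; last by exists e; rewrite ?ve.
  rewrite /rk vt (tops_tau vt) addn0; apply: (@leq_trans (tau u).+1.*2).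
    by rewrite doubleS; case: (u \notin tops); rewrite ?addn1 ?addn0.
  by rewrite leq_double.
have [e [eQ ve me]] := tau_ex vA; have [a ae ra] := mx_mem eQ.
have at_ : a \in tops by apply/topsP; exists e.
exists a; first exact: in_A ae.
split; last by exists e; rewrite ?ve.
by rewrite /rk at_ vt (tops_tau at_) ra me addn0 addn1.
Qed.

Let Call a := [set e : {set P} | [&& #|e| == k, a \in e &
   [forall u in e, rho u <= rho a < rho u + m]]].

Let Qa_Call a : Qa a \subset Call a.
Proof.
apply/subsetP => e; rewrite !inE => /and3P[eQ ae /eqP me]; rewrite Qk // eqxx ae /=.
by apply/forallP => u; apply/implyP => ue; rewrite -{1}me le_mx // (Qspan eQ).
Qed.

Let card_Call a : #|Call a| <= d.
Proof.
pose Wa := [set u | rho u <= rho a < rho u + m].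
have aW : a \in Wa by rewrite inE leqnn /= -[X in X < _]addn0 ltn_add2l; lia.
have Wm : #|Wa| <= m.
  apply: (@card_rho_itv _ ((rho a).+1 - m)) => v; rewrite inE; lia.
have : Call a \subset [set a |: e | e : {set P} in
    [set e : {set P} | (e \subset Wa :\ a) && (#|e| == k - 1)]].
  apply/subsetP => e; rewrite inE => /and3P[/eqP ek ae /forallP eW].
  apply/imsetP; exists (e :\ a); last by rewrite setD1K.
  rewrite inE; apply/andP; split.
    apply: setSD; apply/subsetP => u ue; rewrite inE.
    by have := eW u; rewrite ue.
  have := cardsD1 a e; rewrite ae ek => h; apply/eqP; lia.
move=> /subset_leq_card /leq_trans; apply; apply: (leq_trans (leq_imset_card _ _)).
rewrite cards_draws; apply: leq_bin2l; have := cardsD1 a Wa; rewrite aW; lia.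
Qed.

Let d_ge2 : 2 <= d.
Proof.
rewrite /d; apply: (@leq_trans 'C(k, k - 1)).
  by rewrite -bin_sub; [rewrite subKn ?bin1 // ltnW | exact: leq_subr].
by apply: leq_bin2l; lia.
Qed.

Let full_Call a : #|Qa a| = d -> Qa a = Call a.
Proof. by move=> h; apply/eqP; rewrite eqEcard Qa_Call h card_Call. Qed.

Let top_gt0 a : a \in tops -> exists e u,
  [/\ e \in Q, e \in Qa a, u \in e, u != a & rho u < rho a].
Proof.
move=> /topsP[e [eQ ae me]].
have : 0 < #|e :\ a| by have := cardsD1 a e; rewrite ae Qk //; lia.
move=> /card_gt0P[u]; rewrite !inE => /andP[ua ue]; exists e, u; split => //.
  by rewrite inE eQ ae me eqxx.
rewrite ltn_neqAle -{2}me le_mx // andbT; apply: contra ua => /eqP h.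
by apply/eqP; exact: rho_inj.
Qed.

(** All possible edges ending at [a] are present, so exchanging a vertex [u] puts the predecessor
    [a'] into one of them. Only [a] is new at time [rho a], hence [a'] appeared strictly before,
    which leaves only time [rho a']. *)
Let bad_pred a : a \in tops -> ~~ good a ->
  exists2 a', a' \in tops & (rho a').+1 = rho a.
Proof.
move=> at_; rewrite negbK => /and3P[/eqP full _ /cards1P[x grpa]].
have ga : a \in grp a by rewrite inE tops_A //= tops_tau.
have [e [u [eQ eQa ue ua ra]]] := top_gt0 at_.
have [|a' ra'] := @rho_pred a; first exact: leq_trans ra.
exists a' => //.
have a'a : a' != a by apply/eqP => h; move: ra'; rewrite h; lia.
have [e' e'Qa a'e'] : exists2 e', e' \in Qa a & a' \in e'.
  case: (boolP (a' \in e)) => [a'e|a'e]; first by exists e.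
  exists (a' |: (e :\ u)); last by rewrite !inE eqxx.
  move: eQa; rewrite full_Call // !inE => /and3P[/eqP ek ae /forallP ew].
  rewrite [a == a']eq_sym (negPf a'a) /= [a == u]eq_sym ua ae /=.
  apply/andP; split.
    rewrite cardsU1 !inE negb_and (negPf a'e) orbT.
    by have := cardsD1 u e; rewrite ue ek => h; apply/eqP; lia.
  apply/forallP => w; rewrite !inE; apply/implyP => /orP[/eqP ->|/andP[_ we]].
    lia.
  by have := ew w; rewrite we.
move: (e'Qa); rewrite inE => /and3P[e'Q _ /eqP me'].
apply: tau_tops; first exact: in_A a'e'.
have t1 : tau a' <= rho a by rewrite -me' tau_le.
have t2 : rho a' <= tau a' by rewrite tau_ge // (in_A e'Q).
have : tau a' != rho a; last by lia.
apply/negP => h; have : a' \in grp a by rewrite inE h (in_A e'Q).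
by move: ga; rewrite grpa !inE => /eqP <-; rewrite (negPf a'a).
Qed.

(** Tops that are not good propagate backwards one position at a time. The chain must break within
    [L] steps: at the end of a missing edge, where [d] edges are impossible, or at position 0, which
    is no top because [k >= 2]. *)
Let good_near a : a \in tops -> exists2 c, c \in tops &
  good c && (rho c <= rho a < rho c + L).
Proof.
move=> at_; case: (boolP [exists c in tops, good c && (rho c <= rho a < rho c + L)]).
  by move=> /existsP[c /andP[]]; exists c.
rewrite negb_exists => /forallP nog.
have chain i : i <= rho a -> i < L -> exists2 c, c \in tops & rho c + i = rho a.
  elim: i => [|i IH] ia iL; first by exists a; rewrite ?addn0.
  have [||c ct ci] := IH; try lia.
  have := nog c; rewrite ct /= negb_and => /orP[|]; last by lia.
  by move=> /(bad_pred ct)[c' c't c'c]; exists c' => //; lia.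
have [aL|aL] := leqP L (rho a).+1; last first.
  have [||c ct c0] := chain (rho a); try lia.
  by have [_ [u [_ _ _ _]]] := top_gt0 ct; lia.
have [e [c [eQ ek ce /andP[ca aLc] ew]]] := blocks aL.
have [||c' ct c'c] := chain (rho a - rho c); try lia.
have cc : c' = c by apply: rho_inj; lia.
rewrite cc in ct c'c; exists c => //; rewrite ca aLc !andbT.
apply/negP => /and3P[/eqP /full_Call QC _ _].
have : e \in Call c.
  rewrite inE ek eqxx ce /=; apply/forallP => u; apply/implyP; exact: ew.
by rewrite -QC inE (negPf eQ).
Qed.

(** The edges of a late top lie inside [grp a]. Two new vertices carry at most one edge, and
    [1 + 1 + d <= 2 * d] since [d >= 2]; with three or more, [d + 1 + d <= 3 * d]. *)
Let top_count a : a \in tops -> #|Qa a| + good a + d * late a <= d * #|grp a|.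
Proof.
move=> at_; have Qd : #|Qa a| <= d.
  by apply: leq_trans (card_Call a); exact: subset_leq_card.
have ga : a \in grp a by rewrite inE tops_A //= tops_tau.
have g0 : 0 < #|grp a| by apply/card_gt0P; exists a.
have d2 := d_ge2; rewrite /good; case: (boolP (late a)) => la /=; last first.
  rewrite muln0 addn0; have [d1|d1] := eqVneq #|Qa a| d => /=; last first.
    by apply: leq_trans (leq_pmulr d g0); rewrite addn1 ltn_neqAle d1.
  have [g1|g1] := eqVneq #|grp a| 1 => /=; first by rewrite d1 g1 addn0 muln1.
  have g2 : 2 <= #|grp a| by lia.
  apply: leq_trans (leq_mul (leqnn d) g2).
  by rewrite muln2 -addnn leq_add // ltnW.
rewrite andbF /=.
have Qg e : e \in Qa a -> e \subset grp a.
  move=> eQa; move: (eQa); rewrite inE => /and3P[eQ ae /eqP me].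
  apply/subsetP => u ue; rewrite inE (in_A eQ) //= eqn_leq -{1}me tau_le //= leqNgt.
  apply/negP => hu; move: la => /forallP /(_ u); rewrite hu /= => /negP; apply.
  by apply/existsP; exists e; rewrite eQa.
have [e [u [eQ eQa _ _ _]]] := top_gt0 at_.
have eg := subset_leq_card (Qg e eQa); rewrite Qk // in eg.
have [g2|g3] : #|grp a| = 2 \/ 3 <= #|grp a| by lia.
  have : #|Qa a| <= 1.
    rewrite -(cards1 (grp a)); apply: subset_leq_card; apply/subsetP => e' e'Qa.
    rewrite inE eqEcard Qg //= g2; move: e'Qa; rewrite inE => /and3P[e'Q _ _].
    by rewrite Qk.
  move: d2; rewrite g2; clear; move: #|Qa a| d => x y; lia.
by move: d2 Qd g3; clear; move: #|Qa a| #|grp a| d => x y z; nia.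
Qed.

(** Summing [top_count] gives [|Q| + |gd| + d * |roots| <= d * |A|]. Groups have at most [m]
    vertices and each good top serves at most [L] tops, so [|A| <= m * L * |gd|], which turns the
    savings into a fraction of the non-roots. *)
Lemma forest_exists : exists (rts : {set P}) (rank : P -> nat),
  [/\ rts \subset cover Q,
   forall v, v \in cover Q -> v \notin rts -> exists2 u, u \in cover Q &
     rank u < rank v /\ exists2 e, e \in Q & (v \in e) && (u \in e) &
   m * L * #|Q| + #|cover Q :\: rts| <=
     m * L * 'C(m - 1, k - 1) * #|cover Q :\: rts|].
Proof.
exists roots, rk; split; [|exact: parent|].
  by apply/subsetP => v; rewrite inE => /andP[/tops_A].
have rA : roots \subset A by apply/subsetP => v; rewrite inE => /andP[/tops_A].
rewrite -/A -/d; set N := #|A :\: roots|.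
have NA : N + #|roots| = #|A|.
  by rewrite addnC -(cardsID roots A); move/setIidPr: rA => ->.
pose gd := [set a in tops | good a].
have sumA : \sum_(a in tops) #|grp a| = #|A|.
  rewrite (double_count tops A (fun a v => tau v == rho a)) -sum1_card.
  apply: eq_bigr => v vA; have [e [eQ ve me]] := tau_ex vA.
  have [a ae ra] := mx_mem eQ; apply/eqP/cards1P; exists a.
  apply/setP => b; rewrite !inE; apply/andP/eqP => [[_ /eqP h]|->].
    by apply: rho_inj; rewrite -h ra me.
  by rewrite ra me; split=> //; have /topsP : exists e, [/\ e \in Q, a \in e & mx e = rho a]
    by [exists e]; rewrite inE.
have sumQ : #|Q| <= \sum_(a in tops) #|Qa a|.
  rewrite (double_count tops Q (fun a e => (a \in e) && (mx e == rho a))) -sum1_card.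
  apply: leq_sum => e eQ; have [a ae ra] := mx_mem eQ.
  apply/card_gt0P; exists a; rewrite inE ae ra eqxx !andbT.
  by apply/topsP; exists e.
have cgd : #|gd| = \sum_(a in tops) good a.
  rewrite -sum1_card big_mkcond [RHS]big_mkcond; apply: eq_bigr => a _.
  by rewrite inE; case: (a \in tops); case: (good a).
have crt : #|roots| = \sum_(a in tops) late a.
  rewrite -sum1_card big_mkcond [RHS]big_mkcond; apply: eq_bigr => a _.
  by rewrite inE; case: (a \in tops); case: (late a).
have main : #|Q| + #|gd| + d * #|roots| <= d * #|A|.
  rewrite -sumA cgd crt !big_distrr /=.
  apply: (@leq_trans (\sum_(a in tops) (#|Qa a| + good a + d * late a))).
    by rewrite !big_split /= !leq_add2r.
  by apply: leq_sum => a; exact: top_count.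
have topsL : #|tops| <= #|gd| * L.
  apply: (@leq_trans (\sum_(c in gd) #|[set a in tops | rho c <= rho a < rho c + L]|)).
    rewrite (double_count gd tops (fun c a => rho c <= rho a < rho c + L)) -sum1_card.
    apply: leq_sum => a at_; have [c ct /andP[cg cr]] := good_near at_.
    by apply/card_gt0P; exists c; rewrite inE cr andbT inE ct.
  rewrite -sum_nat_const; apply: leq_sum => c _.
  by apply: (@card_rho_itv _ (rho c)) => v; rewrite inE => /andP[].
have Am : #|A| <= #|tops| * m.
  rewrite -sumA -sum_nat_const; apply: leq_sum => a at_.
  apply: (@card_rho_itv _ ((rho a).+1 - m)) => v; rewrite inE => /andP[vA /eqP tv].
  have [e [eQ ve me]] := tau_ex vA; have [b be rb] := mx_mem eQ.
  by have := Qspan eQ be ve; have := tau_ge vA; lia.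
move: NA main topsL Am; clear.
move: #|A| #|roots| #|gd| #|tops| #|Q| d N => a x g t q y N NA main topsL Am.
have h1 : q + g <= y * N by nia.
have h2 : N <= m * L * g by nia.
have h3 : m * L * (q + g) <= m * L * (y * N) by rewrite leq_mul2l h1 orbT.
by lia.
Qed.

End Forest.

(** * Orderings mapping blocks to edges *)

Lemma card_ffun_in (A B : finType) (F : A -> {set B}) :
  #|[set x : {ffun A -> B} | [forall i, x i \in F i]]| = (\prod_i #|F i|)%N.
Proof.
rewrite (_ : #|_| = #|family F|); first by rewrite card_family foldrE big_map enumT.
apply: eq_card => x; rewrite inE; apply/forallP/familyP => h i; exact: h.
Qed.

(** * Exchanging two disjoint tuples of vertices *)

Section SwapPerm.
Variables (V : finType) (k : nat).
Implicit Types (u x : {ffun 'I_k -> V}).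

Definition swap_fun u x v := if [pick i | u i == v] is Some i then x i
  else if [pick i | x i == v] is Some i then u i else v.

(** Found by search, so that it can be written for arbitrary tuples; it is the intended involution
    once the tuples are injective and disjoint. *)
Definition swap_perm u x : {perm V} :=
  odflt 1%g [pick s : {perm V} | [forall v, s v == swap_fun u x v]].

Variables (u x : {ffun 'I_k -> V}).
Hypotheses (uinj : injective u) (xinj : injective x).
Hypothesis ux : forall i j, u i != x j.

Lemma swap_fun_l i : swap_fun u x (u i) = x i.
Proof.
rewrite /swap_fun; case: pickP => [j /eqP /uinj -> //|/(_ i)]; by rewrite eqxx.
Qed.

Lemma swap_fun_r i : swap_fun u x (x i) = u i.
Proof.
rewrite /swap_fun; case: pickP => [j|_]; first by rewrite (negPf (ux _ _)).
by case: pickP => [j /eqP /xinj -> //|/(_ i)]; rewrite eqxx.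
Qed.

Lemma swap_fun_out v : (forall i, u i != v) -> (forall i, x i != v) ->
  swap_fun u x v = v.
Proof.
move=> hu hx; rewrite /swap_fun; case: pickP => [i|_]; first by rewrite (negPf (hu i)).
by case: pickP => // i; rewrite (negPf (hx i)).
Qed.

Lemma swap_fun_inv : involutive (swap_fun u x).
Proof.
move=> v; case: (pickP (fun i => u i == v)) => [i /eqP <-|hu].
  by rewrite swap_fun_l swap_fun_r.
case: (pickP (fun i => x i == v)) => [i /eqP <-|hx].
  by rewrite swap_fun_r swap_fun_l.
by rewrite !swap_fun_out // => i; rewrite ?hu ?hx.
Qed.

Lemma swap_permE v : swap_perm u x v = swap_fun u x v.
Proof.
rewrite /swap_perm; case: pickP => [s /forallP/(_ v) /eqP //|no].
have := no (perm (inv_inj swap_fun_inv)); rewrite (_ : [forall _, _] = true) //.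
by apply/forallP => w; rewrite permE.
Qed.

End SwapPerm.

Section BlockPerms.
Variables (V : finType) (k t : nat) (H : {set {set V}}) (blk : 'I_t -> 'I_k -> V).
Hypothesis blk_inj : forall j i j' i', blk j i = blk j' i' -> j = j' /\ i = i'.
Hypothesis H_k : forall e, e \in H -> #|e| = k.

Local Notation n := #|V|.

Definition block (j : 'I_t) : {set V} := [set blk j i | i : 'I_k].
Definition blockset : {set V} := \bigcup_j block j.
Definition block_perms (J : {set 'I_t}) : {set {perm V}} :=
  [set f : {perm V} | [forall j in J, f @: block j \in H]].
Definition agree (A : {set V}) (g : V -> V) : {set {perm V}} :=
  [set f in block_perms [set: 'I_t] | [forall a in A, f a == g a]].

Let img (x : {ffun 'I_k -> V}) : {set V} := [set x i | i : 'I_k].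
(** Candidates for the new image of one block; [U] will be the current image of all blocks, so that
    the other blocks stay undisturbed. *)
Definition edge_maps (U : {set V}) : {set {ffun 'I_k -> V}} :=
  [set x : {ffun 'I_k -> V} | [&& injectiveb x, img x \in H & [forall i, x i \notin U]]].

Lemma blk_blockset j i : blk j i \in blockset.
Proof. by apply/bigcupP; exists j => //; apply: imset_f. Qed.

Lemma blocksetP v : reflect (exists j i, v = blk j i) (v \in blockset).
Proof.
apply: (iffP bigcupP) => [[j _ /imsetP[i _ ->]]|[j [i ->]]]; first by exists j, i.
by exists j => //; apply: imset_f.
Qed.

Lemma card_blockset : (#|blockset| <= t * k)%N.
Proof.
apply: (@leq_trans #|[set blk ji.1 ji.2 | ji : 'I_t * 'I_k]|).
  apply: subset_leq_card; apply/subsetP => v /blocksetP[j [i ->]].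
  by apply/imsetP; exists (j, i).
by apply: (leq_trans (leq_imset_card _ _)); rewrite card_prod !card_ord.
Qed.

Lemma block_permsP (J : {set 'I_t}) (f : {perm V}) :
  reflect (forall j, j \in J -> f @: block j \in H) (f \in block_perms J).
Proof.
rewrite inE; apply: (iffP forallP) => h j; first by move=> jJ; have := h j; rewrite jJ.
by apply/implyP; exact: h.
Qed.

Lemma agreeP (A : {set V}) g (f : {perm V}) :
  reflect ((forall j, f @: block j \in H) /\ forall a, a \in A -> f a = g a)
    (f \in agree A g).
Proof.
rewrite inE; apply: (iffP andP) => -[h1 h2]; split.
- by move=> j; apply: (block_permsP _ _ h1); rewrite inE.
- by move=> a aA; have := forallP h2 a; rewrite aA => /eqP.
- by apply/block_permsP => j _; exact: h1.
- by apply/forallP => a; apply/implyP => aA; rewrite h2.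
Qed.

(** Every edge has an enumeration; the bad ones are counted by a coordinate, its value in [U], and
    arbitrary values elsewhere. *)
Lemma card_edge_maps (U : {set V}) :
  (#|H| <= #|edge_maps U| + k * (#|U| * n ^ (k - 1)))%N.
Proof.
pose bad (i0 : 'I_k) := [set x : {ffun 'I_k -> V} | x i0 \in U].
have cbad i0 : #|bad i0| = (#|U| * n ^ (k - 1))%N.
  rewrite (_ : bad i0 = [set x : {ffun 'I_k -> V} |
     [forall i, x i \in if i == i0 then U else [set: V]]]); last first.
    apply/setP => x; rewrite !inE; apply/idP/forallP => [h i|/(_ i0)].
      by case: ifP => [/eqP ->|]; rewrite ?inE.
    by rewrite eqxx.
  rewrite card_ffun_in (bigD1 i0) //= eqxx; congr (_ * _)%N.
  under eq_bigr => i /negPf -> do rewrite cardsT.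
  rewrite prod_nat_const; congr (_ ^ _)%N.
  by have := cardC1 i0; rewrite card_ord -subn1.
have sub : H \subset [set img x | x in edge_maps U :|: \bigcup_i bad i].
  apply/subsetP => e eH.
  have ek : k = #|e| by rewrite H_k.
  pose x := [ffun i : 'I_k => enum_val (cast_ord ek i)].
  have xinj : injective x by move=> i j; rewrite !ffunE => /enum_val_inj /cast_ord_inj.
  have xe : img x = e.
    apply/eqP; rewrite eqEcard; apply/andP; split.
      by apply/subsetP => v /imsetP[i _ ->]; rewrite ffunE enum_valP.
    by rewrite card_imset // card_ord -ek.
  apply/imsetP; exists x => //; rewrite in_setU.
  case: (boolP [forall i, x i \notin U]) => h.
    by rewrite inE; apply/orP; left; rewrite xe eH h !andbT; apply/injectiveP.
  apply/orP; right; move: h; rewrite negb_forall => /existsP[i]; rewrite negbK => xi.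
  by apply/bigcupP; exists i; rewrite ?inE.
apply: (leq_trans (subset_leq_card sub)); apply: (leq_trans (leq_imset_card _ _)).
apply: (leq_trans (leq_card_setU _ _)); rewrite leq_add2l.
apply: (@leq_trans (\sum_(i < k) #|bad i|)%N).
  by apply: (big_ind2 (fun (S : {set _}) c => (#|S| <= c)%N)) => [|S1 c1 S2 c2 h1 h2|//];
    rewrite ?cards0 //; apply: leq_trans (leq_add h1 h2); exact: leq_card_setU.
by under eq_bigr => i _ do rewrite cbad; rewrite sum_nat_const card_ord.
Qed.

Section Resample.
Variables (f : {perm V}) (j : 'I_t) (x : {ffun 'I_k -> V}).
Hypothesis xf : x \in edge_maps (f @: blockset).
Let y := [ffun i => f (blk j i)].

Let xinj : injective x.
Proof. by move: xf; rewrite inE => /and3P[/injectiveP]. Qed.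

Let yinj : injective y.
Proof. by move=> i i'; rewrite !ffunE => /perm_inj /blk_inj[]. Qed.

Let x_out i v : v \in blockset -> x i != f v.
Proof.
move=> vB; move: xf; rewrite inE => /and3P[_ _ /forallP/(_ i) xi].
by apply: contra xi => /eqP ->; apply: imset_f.
Qed.

Let yx i i' : y i != x i'.
Proof. by rewrite ffunE eq_sym x_out // blk_blockset. Qed.

Definition resample := (f * swap_perm y x)%g.

Lemma resample_in i : resample (blk j i) = x i.
Proof.
have -> : resample (blk j i) = swap_perm y x (y i) by rewrite permM ffunE.
by rewrite swap_permE // swap_fun_l.
Qed.

Lemma resample_out v : v \in blockset -> v \notin block j -> resample v = f v.
Proof.
move=> vB vj; rewrite permM swap_permE // swap_fun_out // => i; last exact: x_out.
by rewrite ffunE (inj_eq perm_inj); apply: contra vj => /eqP <-; apply: imset_f.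
Qed.

Lemma resample_perms J : f \in block_perms J -> resample \in block_perms (j |: J).
Proof.
move=> /block_permsP fJ; apply/block_permsP => j'.
have [-> _|jj' /setU1P[/eqP|j'J]] := eqVneq j' j.
  rewrite (_ : _ @: _ = img x); first by move: xf; rewrite inE => /and3P[].
  by rewrite -imset_comp; apply: eq_imset => i /=; exact: resample_in.
  by rewrite (negPf jj').
rewrite (_ : _ @: _ = f @: block j'); first exact: fJ.
apply: eq_in_imset => v vj'; apply: resample_out; first by apply/bigcupP; exists j'.
apply/negP => /imsetP[i _ ve]; move: vj' => /imsetP[i' _]; rewrite ve => /blk_inj[/eqP].
by rewrite eq_sym (negPf jj').
Qed.

End Resample.

Lemma block_perms_neq0 : (forall U : {set V}, (#|U| <= t * k)%N -> edge_maps U != set0) ->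
  block_perms [set: 'I_t] != set0.
Proof.
move=> he; suff hJ (s : seq 'I_t) : exists f, f \in block_perms [set:: s].
  have [f fs] := hJ (enum 'I_t); apply/set0Pn; exists f.
  apply/block_permsP => j _; apply: (block_permsP _ _ fs).
  by rewrite inE mem_enum.
elim: s => [|j s [f fs]].
  by exists 1%g; apply/block_permsP => j; rewrite inE.
have /set0Pn[x xf] : edge_maps (f @: blockset) != set0.
  by apply: he; rewrite (card_imset _ perm_inj) card_blockset.
exists (resample f j x); have := resample_perms j xf fs.
move=> /block_permsP h; apply/block_permsP => j'; rewrite inE => j's.
by apply: h; rewrite !inE.
Qed.

(** A switching: [(f, x)] goes to the resampled permutation together with the old values on block
    [j]. The new permutation displays [x] on that block, so the exchange can be undone; the old
    values on [A :&: block j] are dictated by [g], and the others have at most [n] choices each. *)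
Lemma resample_count (A : {set V}) g j c : A \subset blockset ->
  (forall U : {set V}, (#|U| <= t * k)%N -> (c <= #|edge_maps U|)%N) ->
  (#|agree A g| * c <= #|agree (A :\: block j) g| * n ^ (k - #|A :&: block j|))%N.
Proof.
move=> AB hc.
pose S := [set fx : {perm V} * {ffun 'I_k -> V} |
   (fx.1 \in agree A g) && (fx.2 \in edge_maps (fx.1 @: blockset))].
pose Y := [set y : {ffun 'I_k -> V} |
   [forall i, y i \in if blk j i \in A then [set g (blk j i)] else [set: V]]].
have cY : #|Y| = (n ^ (k - #|A :&: block j|))%N.
  rewrite card_ffun_in (bigID (fun i => blk j i \in A)) /= big1 ?mul1n; last first.
    by move=> i ->; rewrite cards1.
  under eq_bigr => i /negPf -> do rewrite cardsT.
  rewrite prod_nat_const; congr (_ ^ _)%N.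
  have -> : #|A :&: block j| = #|[set i | blk j i \in A]|.
    rewrite -(card_imset _ (_ : injective (blk j))); last by move=> i i' /blk_inj[].
    apply: eq_card => v; rewrite inE; apply/andP/imsetP => [[vA /imsetP[i _ vi]]|[i]].
      by exists i; rewrite // inE -vi.
    by rewrite inE => iA ->; split=> //; apply: imset_f.
  have := cardC [set i | blk j i \in A]; rewrite card_ord => ck.
  have -> : (k - #|[set i | blk j i \in A]| = #|[predC [set i | blk j i \in A]]|)%N.
    by move: ck; move: #|[set i | blk j i \in A]| => c1 ck; lia.
  by apply: eq_card => i; rewrite !inE.
have SP f x : (f, x) \in S -> f \in agree A g /\ x \in edge_maps (f @: blockset).
  by rewrite inE => /andP[].
have cS : (#|agree A g| * c <= #|S|)%N.
  have -> : #|S| = (\sum_(f in agree A g) #|edge_maps (f @: blockset)|)%N.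
    rewrite -sum1_card; under [RHS]eq_bigr => f _ do rewrite -sum1_card.
    by rewrite pair_big_dep /=; apply: eq_bigl => fx; rewrite inE.
  rewrite -sum_nat_const; apply: leq_sum => f _.
  by rewrite hc // (card_imset _ perm_inj) card_blockset.
apply: (leq_trans cS); rewrite -cY -cardsX.
pose h (fx : {perm V} * {ffun 'I_k -> V}) :=
  (resample fx.1 j fx.2, [ffun i => fx.1 (blk j i)]).
rewrite -(card_in_imset (_ : {in S &, injective h})); last first.
  move=> [f x] [f' x'] /SP[fA xf] /SP[f'A xf'] [] e1 e2; have xx : x = x'.
    by apply/ffunP => i; rewrite -(resample_in j xf) -(resample_in j xf') /= e1.
  by congr pair => //; move: e1; rewrite /resample e2 xx => /mulIg.
apply: subset_leq_card; apply/subsetP => _ /imsetP[[f x] /SP[fA xf] ->].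
have [fO fg] := agreeP _ _ _ fA.
rewrite inE /=; apply/andP; split; last first.
  rewrite inE; apply/forallP => i; rewrite ffunE; case: ifP => hi; last by rewrite inE.
  by rewrite fg // inE.
apply/agreeP; split.
  move=> j'; apply: (block_permsP [set: 'I_t]); last by rewrite inE.
  have -> : [set: 'I_t] = j |: [set: 'I_t] by rewrite setUT.
  by apply: resample_perms => //; apply/block_permsP => j'' _; exact: fO.
move=> a; rewrite inE => /andP[aj aA]; rewrite resample_out ?fg //.
exact: (subsetP AB).
Qed.

(** Exchange the values at [w] and at a position [u] of [F]. This is reversible, as [u] is where the
    known value [g w] has gone. *)
Lemma filler_step (A : {set V}) g w : w \in A -> w \notin blockset ->
  (#|agree A g| * (#|~: blockset| - #|(A :\ w) :\: blockset|) <= #|agree (A :\ w) g|)%N.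
Proof.
move=> wA wB; pose F := ~: blockset :\: (A :\ w).
have -> : (#|~: blockset| - #|(A :\ w) :\: blockset|)%N = #|F|.
  rewrite -(cardsID (A :\ w) (~: blockset)).
  have -> : ~: blockset :&: (A :\ w) = (A :\ w) :\: blockset by rewrite setIC -setDE.
  by rewrite addKn.
rewrite -cardsX; pose h (fu : {perm V} * V) := (tperm w fu.2 * fu.1)%g.
rewrite -(card_in_imset (_ : {in setX (agree A g) F &, injective h})); last first.
  move=> [f u] [f' u'] /setXP[/= /agreeP[_ fg] _] /setXP[/= /agreeP[_ f'g] _] e.
  have e1 : h (f, u) u = g w by rewrite /h permM /= tpermR fg.
  have e2 : h (f', u') u' = g w by rewrite /h permM /= tpermR f'g.
  have uu : u = u' by apply: (@perm_inj _ (h (f', u'))); rewrite e2 -e e1.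
  by move: e; rewrite /h /= uu => /mulgI ->.
apply: subset_leq_card; apply/subsetP => f0 /imsetP[[f u] /setXP[/= /agreeP[fO fg] uF] ->{f0}].
move: uF; rewrite /F in_setD in_setC => /andP[uA uB].
have hout v : v != w -> v != u -> h (f, u) v = f v.
  by move=> vw vu; rewrite /h permM tpermD // eq_sym.
apply/agreeP; split.
  move=> j; rewrite (_ : _ @: _ = f @: block j) //; apply: eq_in_imset => v vj.
  have vB : v \in blockset by apply/bigcupP; exists j.
  by apply: hout; apply/eqP => ve; move: vB; rewrite ve ?(negPf wB) ?(negPf uB).
move=> a aA; rewrite hout; first by apply: fg; move: aA; rewrite inE => /andP[].
  by move: aA; rewrite !inE => /andP[].
by apply: contra uA => /eqP <-.
Qed.

Lemma filler_count (A : {set V}) g :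
  (#|agree A g| * (#|~: blockset| ^_ #|A :\: blockset|) <= #|agree (A :&: blockset) g|)%N.
Proof.
move cA : #|A :\: blockset| => a; elim: a A cA => [|a IH] A cA.
  rewrite ffactn0 muln1; apply: subset_leq_card; apply/subsetP => f /agreeP[fO fg].
  by apply/agreeP; split=> // v; rewrite inE => /andP[vA _]; exact: fg.
have : (0 < #|A :\: blockset|)%N by rewrite cA.
move=> /card_gt0P[w]; rewrite inE => /andP[wB wA].
have Aw : #|(A :\ w) :\: blockset| = a.
  have := cardsD1 w (A :\: blockset); rewrite inE wA wB cA => -[->].
  by apply: eq_card => v; rewrite !inE; case: (v == w); case: (v \in A); case: (v \in _).
have e : (A :\ w) :&: blockset = A :&: blockset.
  apply/setP => v; rewrite !inE; case: eqVneq => //= ->.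
  by rewrite (negPf wB) andbF.
have := IH _ Aw; rewrite e; apply: leq_trans.
rewrite ffactnSr mulnCA (mulnC (_ ^_ _)) leq_mul2r; apply/orP; right.
by rewrite -[in X in (_ * X <= _)%N]Aw; exact: filler_step.
Qed.

End BlockPerms.

(** The induction rests on [(1 + 1/N) ^ a <= expR (a/N) <= expR 1] for [a <= N]. *)
Lemma ffact_lower (R : realType) (N a : nat) : (a <= N)%N ->
  N%:R ^+ a <= expR 1 ^+ a * (N ^_ a)%:R :> R.
Proof.
elim: a N => [|a IH] [|N] // aN; first by rewrite !expr0 ffactn0 mul1r.
  by rewrite !expr0 ffactn0 mul1r.
have IH' := IH N aN; rewrite exprS ffactSS natrM [X in _ <= X * _]exprS.
rewrite mulrACA [X in _ <= X * _]mulrC -mulrA; apply: ler_wpM2l => //.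
apply: (@le_trans _ _ (expR 1 * N%:R ^+ a)); last first.
  by apply: ler_wpM2l => //; exact: expR_ge0.
have [NE|N0] := posnP N.
  have -> : a = 0%N by lia.
  by rewrite !expr0 mulr1 -[X in X <= _]expR0 ler_expR.
have N0' : 0 < N%:R :> R by rewrite ltr0n.
rewrite -ler_pdivrMr ?exprn_gt0 // -expr_div_n.
have -> : N.+1%:R / N%:R = 1 + N%:R^-1 :> R.
  by rewrite -natr1 mulrDl mulfV ?mul1r // gt_eqF.
apply: (@le_trans _ _ (expR N%:R^-1 ^+ a)).
  by apply: lerXn2r; rewrite ?nnegrE ?expR_ge0 ?addr_ge0 ?invr_ge0 ?expR_ge1Dx.
rewrite -expRM_natl ler_expR ler_pdivrMr // mul1r ler_nat.
by [].
Qed.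

(** Releasing a block that meets [A] in [l >= 1] positions costs one factor [K], absorbed in
    [K ^+ l]. A filler position costs [expR 1 / F], at most [K / n] since at least half of the
    positions are fillers. *)
Lemma agree_spread (R : realType) (V : finType) (k t : nat) (H : {set {set V}})
    (blk : 'I_t -> 'I_k -> V) (c : nat) (K : R) (A : {set V}) (g : V -> V) :
  (forall j i j' i', blk j i = blk j' i' -> j = j' /\ i = i') ->
  (forall U : {set V}, (#|U| <= t * k)%N -> (c <= #|edge_maps k H U|)%N) ->
  (0 < #|V|)%N -> (#|V| <= 2 * #|~: blockset blk|)%N ->
  1 <= K -> #|V|%:R ^+ k <= K * c%:R -> 2 * expR 1 <= K ->
  #|agree H blk A g|%:R <=
    (K / #|V|%:R) ^+ #|A| * #|block_perms H blk [set: 'I_t]|%:R.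
Proof.
move=> binj hc n0 nF K1 Kc Ke; set n := #|V| in n0 nF Kc *.
set Om := block_perms _ _ _; set B := blockset blk.
have n0' : 0 < n%:R :> R by rewrite ltr0n.
have K0 : 0 < K by apply: lt_le_trans K1.
have Kn : 0 <= K / n%:R by rewrite divr_ge0 // ltW.
have blocks (A' : {set V}) : A' \subset B ->
   #|agree H blk A' g|%:R <= (K / n%:R) ^+ #|A'| * #|Om|%:R.
  have [s] := ubnP #|A'|; elim: s A' => // s IH A' As AB.
  have [->|[a aA]] := set_0Vmem A'.
    rewrite cards0 expr0 mul1r ler_nat; apply: subset_leq_card.
    by apply/subsetP => f /agreeP[h _]; apply/block_permsP.
  have /blocksetP[j [i ai]] := subsetP AB _ aA.
  have := resample_count binj g j AB hc; set A1 := A' :\: _; set l := #|A' :&: _|.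
  have lk : (l <= k)%N.
    apply: (@leq_trans #|block blk j|); first by rewrite subset_leq_card // subsetIr.
    by rewrite (leq_trans (leq_imset_card _ _)) // card_ord.
  have l1 : (0 < l)%N.
    by apply/card_gt0P; exists a; rewrite inE aA ai imset_f.
  have lA : (l + #|A1|)%N = #|A'| by rewrite cardsID.
  have IH1 : #|agree H blk A1 g|%:R <= (K / n%:R) ^+ #|A1| * #|Om|%:R.
    by apply: IH; [lia | apply: subset_trans AB; exact: subsetDl].
  rewrite -(ler_nat R) !natrM natrX => hcount.
  have nk0 : 0 < n%:R ^+ k :> R by rewrite exprn_gt0.
  have step : #|agree H blk A' g|%:R <= (K / n%:R) ^+ l * #|agree H blk A1 g|%:R.
    rewrite -(ler_pM2r nk0); apply: (le_trans (ler_wpM2l _ Kc)) => //.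
    rewrite mulrCA; apply: (le_trans (ler_wpM2l (ltW K0) hcount)).
    have -> : n%:R ^+ k = n%:R ^+ l * n%:R ^+ (k - l) :> R by rewrite -exprD subnKC.
    rewrite mulrA [X in _ <= X]mulrA; apply: ler_wpM2r; first by rewrite exprn_ge0.
    rewrite expr_div_n mulrAC mulfVK ?gt_eqF ?exprn_gt0 //; apply: ler_wpM2r => //.
    by rewrite -[X in X <= _]expr1 ler_weXn2l.
  apply: (le_trans step); rewrite -lA exprD -mulrA; apply: ler_wpM2l => //.
  exact: exprn_ge0.
have := filler_count H blk A g.
set F := #|~: _|; set a := #|A :\: _| => hf.
have aF : (a <= F)%N by rewrite subset_leq_card // setDE subsetIr.
have F0 : (0 < F)%N by rewrite /F; lia.
have F0' : 0 < F%:R :> R by rewrite ltr0n.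
have cA : (#|A :&: B| + a)%N = #|A| by rewrite cardsID.
have := blocks (A :&: B) (subsetIr _ _) => hb.
have fill : #|agree H blk A g|%:R <= (K / n%:R) ^+ a * #|agree H blk (A :&: B) g|%:R.
  apply: (@le_trans _ _ ((expR 1 / F%:R) ^+ a * #|agree H blk (A :&: B) g|%:R)).
    rewrite expr_div_n mulrAC ler_pdivlMr ?exprn_gt0 //.
    apply: (le_trans (ler_wpM2l _ (ffact_lower R aF))) => //.
    rewrite mulrCA; apply: ler_wpM2l; first by rewrite exprn_ge0 ?expR_ge0.
    by rewrite -natrM ler_nat.
  apply: ler_wpM2r => //; apply: lerXn2r; rewrite ?nnegrE //.
  rewrite ler_pdivrMr // mulrAC ler_pdivlMr //.
  apply: (@le_trans _ _ (expR 1 * (2 * F%:R))).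
    by rewrite ler_wpM2l ?expR_ge0 // -natrM ler_nat.
  by rewrite mulrA [expR 1 * 2]mulrC; apply: ler_wpM2r.
apply: (le_trans fill); rewrite -cA addnC exprD -mulrA; apply: ler_wpM2l => //.
exact: exprn_ge0.
Qed.

(** * Spread of the family of tight cycle powers *)

Section Cyclic.
Variable (n' : nat).
Local Notation n := n'.+1.
Local Notation V := 'I_n.
Implicit Types (a b x y u v i : V) (m k : nat).

Lemma val_subr a b : val (a - b) = (if (b <= a)%N then a - b else a + n - b)%N.
Proof.
have la := ltn_ord a; have lb := ltn_ord b.
rewrite /= modnDmr; case: ifP => ab.
  by rewrite addnBA ?(ltnW lb) // addnC -addnBA // modnDl modn_small //; lia.
by rewrite modn_small; lia.
Qed.

Lemma val_subrD a b x : (val (b - x)%R + val (a - b)%R < n)%N ->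
  (val (a - x)%R = val (b - x)%R + val (a - b)%R)%N.
Proof.
have la := ltn_ord a; have lb := ltn_ord b; have lx := ltn_ord x.
by rewrite !val_subr; case: (leqP b a); case: (leqP x a); case: (leqP x b); lia.
Qed.

Definition arc m i : {set V} := [set x : V | (val (x - i)%R < m)%N].

Lemma cyc_windowE m i : (m <= n)%N -> cyc_window m i = arc m i.
Proof.
move=> mn; apply/setP => x; rewrite !inE val_subr.
have lx := ltn_ord x; have li := ltn_ord i.
apply/existsP/idP => [[j /eqP ->]|].
  have lj := ltn_ord j.
  have [h|h] := ltnP (i + j)%N n.
    by rewrite modn_small // leq_addr addKn.
  have -> : ((i + j) %% n = i + j - n)%N.
    by rewrite -{1}(subnK h) modnDr modn_small //; lia.
  by case: ifP; lia.
case: ifP => ix h.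
  by exists (Ordinal h); rewrite /= subnKC // modn_small.
exists (Ordinal h); rewrite /=; apply/eqP.
have -> : (i + (x + n - i) = x + n)%N by lia.
by rewrite modnDr modn_small.
Qed.

Lemma sub_inj x : injective (fun a => val (a - x)).
Proof. by move=> a b /val_inj /addIr. Qed.

Lemma card_arc m i : (#|arc m i| <= m)%N.
Proof.
apply: (@card_rho_itv _ (fun a => val (a - i)) (@sub_inj i) _ 0) => v.
by rewrite inE.
Qed.

Lemma card_arc_eq m i : (m <= n)%N -> #|arc m i| = m.
Proof.
move=> mn; apply/eqP; rewrite eqn_leq card_arc /= -{1}(card_ord m).
have inj : injective (fun j : 'I_m => i + inord j : V).
  move=> j j' /addrI /(congr1 val) /=.
  by rewrite !inordK ?(leq_trans (ltn_ord _)) // => /val_inj.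
rewrite -cardsT -(card_imset _ inj); apply: subset_leq_card.
apply/subsetP => _ /imsetP[j _ ->]; rewrite inE addrC addKr.
by rewrite /= inordK ?(leq_trans (ltn_ord _)).
Qed.

Definition near0 m : {set V} := [set y : V | (val y < m)%N || (val (- y)%R < m)%N].

Lemma card_near0 m : (#|near0 m| <= 2 * m)%N.
Proof.
have sub : near0 m \subset arc m 0 :|: -%R @: arc m 0.
  apply/subsetP => y; rewrite !inE subr0 => /orP[->//|h].
  apply/orP; right; apply/imsetP; exists (- y); rewrite ?opprK // inE subr0.
  exact: h.
apply: (leq_trans (subset_leq_card sub)); apply: (leq_trans (leq_card_setU _ _)).
rewrite mul2n -addnn leq_add ?card_arc //.
by apply: (leq_trans (leq_imset_card _ _)); exact: card_arc.
Qed.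

Lemma arc_near0 m i u v : u \in arc m i -> v \in arc m i -> u - v \in near0 m.
Proof.
rewrite !inE => hu hv; move: hu hv; rewrite opprB.
have lu := ltn_ord u; have lv := ltn_ord v; have li := ltn_ord i.
by rewrite !val_subr; case: (leqP i u); case: (leqP i v); case: (leqP v u);
  case: (leqP u v); lia.
Qed.

Definition tight_edges k m : {set {set V}} :=
  [set c : {set V} | (#|c| == k) && [exists i, c \subset arc m i]].

Lemma card_tight_edges k m : (#|tight_edges k m| <= n * 2 ^ m)%N.
Proof.
apply: (@leq_trans #|\bigcup_i powerset (arc m i)|).
  apply: subset_leq_card; apply/subsetP => c; rewrite inE => /andP[_ /existsP[i ci]].
  by apply/bigcupP; exists i; rewrite // inE.
apply: (@leq_trans (\sum_(i : V) #|powerset (arc m i)|)%N).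
  by apply: (big_ind2 (fun (S : {set _}) c => (#|S| <= c)%N)) => [|S1 c1 S2 c2 h1 h2|//];
    rewrite ?cards0 //; apply: leq_trans (leq_add h1 h2); exact: leq_card_setU.
apply: (@leq_trans (\sum_(i : V) 2 ^ m)%N); last by rewrite sum_nat_const card_ord.
by apply: leq_sum => i _; rewrite card_powerset leq_exp2l // card_arc.
Qed.

(* The cut between x - 1 and x does not separate the vertices of e. *)
Definition uncut m x (e : {set V}) : bool :=
  [forall u in e, forall v in e, (val (u - x)%R < val (v - x)%R + m)%N].

Lemma uncutP m x (e : {set V}) : reflect
  (forall u v, u \in e -> v \in e -> (val (u - x)%R < val (v - x)%R + m)%N)
  (uncut m x e).
Proof.
apply: (iffP forallP) => [h u v ue ve|h u].
  by have := h u; rewrite ue => /forallP/(_ v); rewrite ve.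
by apply/implyP => ue; apply/forallP => v; apply/implyP => ve; exact: h.
Qed.

Lemma cut_arc m x i (e : {set V}) : e \subset arc m i -> ~~ uncut m x e -> x \in arc m i.
Proof.
move=> ei; apply: contraR => xi; apply/uncutP => u v ue ve.
have := subsetP ei _ ue; have := subsetP ei _ ve; move: xi; rewrite !inE !val_subr.
have lu := ltn_ord u; have lv := ltn_ord v; have li := ltn_ord i; have lx := ltn_ord x.
by case: (leqP i x); case: (leqP i v); case: (leqP i u); case: (leqP x v);
   case: (leqP x u); lia.
Qed.

(** An edge separated by the cut lies in an arc through [x], hence within distance less than [m] of
    [x]. *)
Lemma card_cut m x k (Q : {set {set V}}) : Q \subset tight_edges k m ->
  (#|[set e in Q | ~~ uncut m x e]| <= 2 ^ (2 * m))%N.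
Proof.
move=> QC; apply: (@leq_trans #|powerset [set u : V | u - x \in near0 m]|); last first.
  rewrite card_powerset leq_exp2l //; apply: leq_trans (card_near0 m).
  rewrite -(card_imset _ (@addIr _ (- x))); apply: subset_leq_card.
  by apply/subsetP => z /imsetP[u hu ->]; rewrite inE in hu.
apply: subset_leq_card; apply/subsetP => e; rewrite !inE => /andP[eQ cut].
have := subsetP QC _ eQ; rewrite inE => /andP[_ /existsP[i ei]].
apply/subsetP => u ue; rewrite inE; apply: (@arc_near0 m i); first exact: (subsetP ei).
exact: cut_arc ei cut.
Qed.

Lemma all_cut m k (Q : {set {set V}}) : Q \subset tight_edges k m ->
  (forall x, exists2 e, e \in Q & ~~ uncut m x e) -> (n <= #|Q| * m)%N.
Proof.
move=> QC hcut.
apply: (@leq_trans (\sum_(e in Q) #|[set x in [set: V] | ~~ uncut m x e]|)%N).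
  rewrite (double_count Q [set: V] (fun e x => ~~ uncut m x e)).
  apply: (@leq_trans (\sum_(x in [set: V]) 1)%N).
    by rewrite sum1_card cardsT card_ord.
  apply: leq_sum => x _.
  by have [e eQ he] := hcut x; apply/card_gt0P; exists e; rewrite inE eQ.
rewrite -sum_nat_const; apply: leq_sum => e eQ.
have := subsetP QC _ eQ; rewrite inE => /andP[_ /existsP[i ei]].
apply: leq_trans (card_arc m i); apply: subset_leq_card.
by apply/subsetP => x; rewrite !inE => h; have := cut_arc ei h; rewrite inE.
Qed.

End Cyclic.

(** * Spread from forest codes, and edges that wrap around the cycle *)

Section CyclicSpread.
Variables (R : realType) (n' : nat).
Local Notation n := n'.+1.
Local Notation V := 'I_n.
Variables (k m t L : nat) (H : {set {set V}}) (blk : 'I_t -> 'I_k -> V) (st : 'I_t -> V).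
Hypothesis k_ge2 : (2 <= k)%N.
Hypothesis k_lt_m : (k < m)%N.
Hypothesis m_le_n : (m <= n)%N.
Hypothesis block_arc : forall j, block blk j = arc k (st j).
Hypothesis st_dense : forall b : V, exists j, (val (st j - b)%R < L)%N.

Definition free_edges : {set {set V}} :=
  tight_edges _ k m :\: [set block blk j | j : 'I_t].
Definition power_edges (f : {perm V}) : {set {set V}} :=
  [set f @: (c : {set V}) | c in free_edges].

Local Notation d := 'C(m - 1, k - 1).
Local Notation M := (m * (L + k))%N.
Local Notation Om := (block_perms H blk [set: 'I_t]).

Lemma forest_cyclic (Q : {set {set V}}) (x : V) : Q \subset free_edges ->
  (forall e, e \in Q -> uncut m x e) ->
  exists (rts : {set V}) (rank : V -> nat),
  [/\ rts \subset cover Q,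
   forall v, v \in cover Q -> v \notin rts -> exists2 u, u \in cover Q &
     (rank u < rank v)%N /\ exists2 e, e \in Q & (v \in e) && (u \in e) &
   (M * #|Q| + #|cover Q :\: rts| <= M * d * #|cover Q :\: rts|)%N].
Proof.
move=> QF hx; apply: (@forest_exists _ (fun a => val (a - x)) k m (L + k)) => //.
- exact: sub_inj.
- move=> a a0; exists (a - inord 1 : V); move: a0.
  rewrite addrAC; move: (a - x) => z z0; rewrite val_subr inordK; last by lia.
  by have lz := ltn_ord z; have := z0; rewrite /=; case: ifP; lia.
- by move=> e /(subsetP QF); rewrite !inE => /andP[_ /andP[/eqP]].
- by move=> e u v eQ ue ve; have /uncutP := hx e eQ; apply.
(* Far enough back that a block starting within [L] positions from [b] ends no later than [a]; this
   is why [L + k] replaces [L]. *)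
move=> a aL; pose b : V := a - inord (L + k - 1).
have la := ltn_ord a; have lx := ltn_ord x; 
have la' : (val (a - x)%R < n)%N by exact: ltn_ord.
have bx : (val (b - x)%R = val (a - x)%R - (L + k - 1))%N.
  rewrite /b addrAC val_subr inordK; last by lia.
  by move: aL la' => /=; case: ifP; lia.
have [j hj] := st_dense b; set s := st j in hj.
have sx : (val (s - x)%R = val (b - x)%R + val (s - b)%R)%N.
  by apply: val_subrD; lia.
exists (arc k s), (s + inord (k - 1) : V).
have kn : (k <= n)%N by lia.
have cs : (val (s + inord (k - 1) - s)%R = k - 1)%N.
  by rewrite addrC addKr [LHS]inordK //; lia.
have hu u : u \in arc k s -> (val (u - x)%R = val (s - x)%R + val (u - s)%R)%N.
  by rewrite inE => us; apply: val_subrD; lia.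
have cin : s + inord (k - 1) \in arc k s by rewrite inE cs; lia.
have hc := hu _ cin; rewrite cs in hc.
split => //.
- apply/negP => /(subsetP QF); rewrite inE => /andP[/negP + _]; apply.
  by apply/imsetP; exists j; rewrite // block_arc.
- exact: card_arc_eq.
- by rewrite hc sx bx; move: (val (s - b)) (val (a - x)) hj aL => y z; lia.
by move=> u us; rewrite (hu u us) hc; move: us; rewrite inE; lia.
Qed.

(** [f] is coded by the places where it puts the vertices of [f0 @: A]: a position for each root, an
    offset from the parent for each other vertex. There are at most [n ^ |rts| * (2 * m) ^ N] codes,
    and each fixes [f] on [|A|] positions. *)
Lemma spread_uncut (K : R) (f0 : {perm V}) (Q : {set {set V}}) (x : V) (w : R) :
  (forall A g, #|agree H blk A g|%:R <= (K / n%:R) ^+ #|A| * #|Om|%:R) ->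
  1 <= K -> 0 < w <= 1 -> w ^+ (M * d - 1) = n%:R^-1 ->
  Q \subset free_edges -> (forall e, e \in Q -> uncut m x e) ->
  #|[set f in Om | [set f0 @: (e : {set V}) | e in Q] \subset power_edges f]|%:R
    <= (((2 * m)%:R * K) ^+ k * w ^+ M) ^+ #|Q| * #|Om|%:R.
Proof.
move=> spr K1 /andP[w0 w1] wn QF hx.
have [rts [rank [rA par cnt]]] := forest_cyclic QF hx.
set A := cover Q in rA par cnt *; set N := #|A :\: rts| in cnt *.
set E := [set f in Om | _].
have n0 : 0 < n%:R :> R by rewrite ltr0n.
have K0 : 0 < K by apply: lt_le_trans K1.
pose ph (f : {perm V}) a := (f^-1)%g (f0 a).
pose pr v := odflt v [pick u | [&& u \in A, (rank u < rank v)%N &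
   [exists e in Q, (v \in e) && (u \in e)]]].
have prP v : v \in A -> v \notin rts -> [/\ pr v \in A, (rank (pr v) < rank v)%N &
   exists2 e, e \in Q & (v \in e) && (pr v \in e)].
  move=> vA vr; rewrite /pr; case: pickP => [u /and3P[uA ur /existsP[e /andP[eQ ve]]]|no].
    by split=> //; exists e.
  have [u uA [ur [e eQ ve]]] := par v vA vr; have := no u; rewrite uA ur /=.
  by move=> /negbT /existsP[]; exists e; rewrite eQ.
pose code f : {ffun V -> V} := [ffun a => if a \in A then
   (if a \in rts then ph f a else ph f a - ph f (pr a)) else 0].
pose CF a : {set V} := if a \in A then (if a \in rts then [set: V] else near0 n' m)
   else [set 0].
pose Codes := [set y : {ffun V -> V} | [forall a, y a \in CF a]].
have cCodes : (#|Codes| <= n ^ #|rts| * (2 * m) ^ N)%N.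
  rewrite card_ffun_in (bigID (mem A)) /= [X in (_ * X)%N]big1 ?muln1; last first.
    by move=> a /negPf aA; rewrite /CF aA cards1.
  rewrite (bigID (mem rts)) /=; apply: leq_mul.
    rewrite (eq_bigr (fun=> n)) => [|a /andP[aA ar]]; last first.
      by rewrite /CF aA ar cardsT card_ord.
    rewrite prod_nat_const leq_pexp2l //; apply: subset_leq_card.
    by apply/subsetP => a; rewrite unfold_in => /andP[].
  apply: (@leq_trans (\prod_(a | (a \in A) && (a \notin rts)) (2 * m))%N).
    apply: leq_prod => a /andP[aA /negPf ar]; rewrite /CF aA ar; exact: card_near0.
  rewrite prod_nat_const; apply: leq_pexp2l; first by lia.
  apply: subset_leq_card; apply/subsetP => a; rewrite unfold_in => /andP[aA ar].
  by rewrite inE ar.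
have codeE f : f \in E -> code f \in Codes.
  rewrite inE => /andP[_ fS]; rewrite inE; apply/forallP => a; rewrite ffunE /CF.
  case: ifP => [aA|_]; last by rewrite inE.
  case: ifP => [_|/negbT ar]; first by rewrite inE.
  have [pA _ [e eQ /andP[ae pe]]] := prP a aA ar.
  have /imsetP[c cF ec] : f0 @: e \in power_edges f.
    by apply: (subsetP fS); apply: imset_f.
  have : c \in tight_edges n' k m by move: cF; rewrite inE => /andP[].
  rewrite inE => /andP[_ /existsP[i ci]].
  have phe b : b \in e -> ph f b \in arc m i.
    move=> be; apply: (subsetP ci); have : f0 b \in f0 @: e by apply: imset_f.
    by rewrite ec => /imsetP[b' b'c eb]; rewrite /ph eb permK.
  by apply: (@arc_near0 _ m i); exact: phe.
have class (y : {ffun V -> V}) :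
   #|[set f in E | code f == y]|%:R <= (K / n%:R) ^+ #|A| * #|Om|%:R.
  have [->|[f1]] := set_0Vmem [set f in E | code f == y].
    by rewrite cards0 mulr_ge0 // exprn_ge0 // divr_ge0 // ltW.
  rewrite inE => /andP[f1E /eqP f1y].
  (* Reading the offsets in order of increasing rank recovers [ph f] on all of [A]. *)
  have sub : [set f in E | code f == y] \subset agree H blk (ph f1 @: A) f1.
    apply/subsetP => f; rewrite inE => /andP[fE /eqP fy].
    have phE a : a \in A -> ph f a = ph f1 a.
      have [s] := ubnP (rank a); elim: s a => // s IH a as_ aA.
      have := congr1 (fun z : {ffun V -> V} => z a) (etrans fy (esym f1y)).
      rewrite !ffunE aA.
      case: ifP => [//|/negbT ar].
      have [pA pr_lt _] := prP a aA ar; rewrite (IH (pr a)) //; last exact: leq_trans pr_lt as_.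
      by move/addIr.
    apply/agreeP; split.
      by move: fE; rewrite inE => /andP[/block_permsP h _] j; apply: h; rewrite inE.
    by move=> _ /imsetP[a aA ->]; rewrite -{1}phE // /ph !permKV.
  apply: le_trans (_ : #|agree H blk (ph f1 @: A) f1|%:R <= _).
    by rewrite ler_nat subset_leq_card.
  apply: (le_trans (spr _ _)); rewrite card_imset //.
  by move=> a b /perm_inj /perm_inj.
have cE : #|E|%:R <= (n ^ #|rts| * (2 * m) ^ N)%:R * ((K / n%:R) ^+ #|A| * #|Om|%:R).
  have -> : #|E| = (\sum_(y in Codes) #|[set f in E | code f == y]|)%N.
    rewrite -sum1_card (partition_big code (mem Codes)) //=.
    by apply: eq_bigr => y _; rewrite -sum1_card; apply: eq_bigl => f; rewrite [in RHS]inE.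
  rewrite natr_sum; apply: (le_trans (ler_sum _ (fun y _ => class y))).
  rewrite sumr_const -[X in X <= _]mulr_natl; apply: ler_wpM2r; last by rewrite ler_nat.
  by rewrite mulr_ge0 // exprn_ge0 // divr_ge0 // ltW.
apply: (le_trans cE); rewrite mulrA; apply: ler_wpM2r => //.
have cA : (#|rts| + N)%N = #|A| by rewrite -(cardsID rts A); move/setIidPr: rA => ->.
have Ak : (#|A| <= k * #|Q|)%N.
  have [cov _] := leq_card_cover Q; apply: (leq_trans cov); rewrite mulnC -sum_nat_const.
  by apply: leq_sum => e /(subsetP QF); rewrite !inE => /andP[_ /andP[/eqP -> _]].
rewrite natrM !natrX expr_div_n -cA (exprD n%:R).
have -> : n%:R ^+ #|rts| * (2 * m)%:R ^+ N * (K ^+ (#|rts| + N) / (n%:R ^+ #|rts| * n%:R ^+ N))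
  = (2 * m)%:R ^+ N * K ^+ (#|rts| + N) * n%:R^-1 ^+ N.
  rewrite exprVn invfM [_ * (2 * m)%:R ^+ N]mulrC -!mulrA; congr (_ * _).
  by rewrite [LHS]mulrCA; congr (_ * _); rewrite mulVKf // expf_neq0 // gt_eqF.
rewrite exprMn -!exprM -wn -exprM.
have m1 : 1 <= (2 * m)%:R :> R by rewrite ler1n; lia.
apply: ler_pM.
- by rewrite mulr_ge0 // exprn_ge0 // ltW.
- by rewrite exprn_ge0 // ltW.
- rewrite exprMn; apply: ler_pM; rewrite ?exprn_ge0 ?(ltW K0) //.
    by rewrite ler_weXn2l // (leq_trans _ Ak) // -cA leq_addl.
  by rewrite ler_weXn2l // cA.
(* The forest bound says [M * |Q| <= (M * d - 1) * N], and [n ^ -N] is the power of [w] with the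
   right side as exponent. *)
apply: ler_wiXn2l => //; first exact: ltW.
rewrite mulnBl mul1n; move: (M * #|Q|)%N (M * d * N)%N cnt => y z; clearbody N; clear.
by lia.
Qed.

Lemma spread_cyclic (K : R) (w : R) :
  (forall A g, #|agree H blk A g|%:R <= (K / n%:R) ^+ #|A| * #|Om|%:R) ->
  1 <= K -> 0 < w <= 1 -> w ^+ (M * d - 1) = n%:R^-1 -> (0 < L)%N ->
  (n ^ (2 ^ (2 * m) * m) <= 2 ^ n)%N ->
  forall S : {set {set V}}, #|[set f in Om | S \subset power_edges f]|%:R
    <= (2 * (((2 * m)%:R * K) ^+ k * w ^+ M)) ^+ #|S| * #|Om|%:R.
Proof.
move=> spr K1 w01 wn L0 nbig S; set q0 := _ * w ^+ M.
have /andP[w0 w1] := w01.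
have K0 : 0 < K by apply: lt_le_trans K1.
have m1 : 1 <= (2 * m)%:R :> R by rewrite ler1n; lia.
have wM : n%:R^-1 <= w ^+ M.
  rewrite -wn; apply: ler_wiXn2l => //; first exact: ltW.
  have d2 : (2 <= d)%N.
    apply: (@leq_trans 'C(k, k - 1)).
      by rewrite -bin_sub; [rewrite subKn ?bin1 // ltnW | exact: leq_subr].
    by apply: leq_bin2l; lia.
  have M1 : (0 < M)%N by rewrite muln_gt0; lia.
  by move: M1 d2; move: (m * (L + k))%N d => y z; nia.
have q0n : n%:R^-1 <= q0.
  apply: (le_trans wM); rewrite ler_peMl ?exprn_ge0 ?(ltW w0) //.
  by apply: exprn_ege1; apply: mulr_ege1.
have n0 : 0 < n%:R :> R by rewrite ltr0n.
have q0p : 0 < q0 by apply: lt_le_trans q0n; rewrite invr_gt0.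
have [->|[f0]] := set_0Vmem [set f in Om | S \subset power_edges f].
  by rewrite cards0 mulr_ge0 // exprn_ge0 // mulr_ge0 // ltW.
rewrite inE => /andP[f0O f0S].
pose Q := [set c in free_edges | f0 @: (c : {set V}) \in S].
have imf_inj : injective (fun c : {set V} => f0 @: c) by apply: imset_inj; exact: perm_inj.
have QS : [set f0 @: (e : {set V}) | e in Q] = S.
  apply/setP => s; apply/imsetP/idP => [[c]|sS]; first by rewrite inE => /andP[_ cS] ->.
  have /imsetP[c cF sc] := subsetP f0S _ sS; exists c => //.
  by rewrite inE cF -sc.
have QF : Q \subset free_edges by apply/subsetP => c; rewrite inE => /andP[].
have QC : Q \subset tight_edges n' k m by apply: (subset_trans QF); exact: subsetDl.
have cQ : #|S| = #|Q| by rewrite -QS card_imset.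
case: (pickP (fun x : V => [forall e in Q, uncut m x e])) => [x /forallP hx|no].
  rewrite cQ -{1}QS.
  apply: (le_trans (spread_uncut f0 spr K1 w01 wn QF (x := x) _)).
    by move=> e eQ; have := hx e; rewrite eQ.
  apply: ler_wpM2r => //; apply: lerXn2r; rewrite ?nnegrE -/q0.
  - exact: ltW.
  - by apply: mulr_ge0 => //; exact: ltW.
  by rewrite ler_peMl ?(ltW q0p) // ler1n.
have nQ : (n <= #|Q| * m)%N.
  apply: (all_cut QC) => x; have /negbT := no x; rewrite negb_forall => /existsP[e].
  by rewrite negb_imply => /andP[eQ he]; exists e.
(* Every cut is crossed, so any will do. At most [2 ^ (2 * m)] edges are dropped, each costing a
   factor at most [n] because [q0 >= 1/n]; the factor [2 ^ |Q|] with [|Q| >= n/m] covers this. *)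
pose x : V := 0; pose Q' := [set e in Q | uncut m x e].
have Q'Q : Q' \subset Q by apply/subsetP => e; rewrite inE => /andP[].
have := spread_uncut f0 spr K1 w01 wn (subset_trans Q'Q QF) (x := x) _.
move=> /(_ _) h.
have {}h : #|[set f in Om | [set f0 @: (e : {set V}) | e in Q'] \subset power_edges f]|%:R
    <= q0 ^+ #|Q'| * #|Om|%:R.
  by apply: h => e; rewrite inE => /andP[].
apply: (@le_trans _ _ (q0 ^+ #|Q'| * #|Om|%:R)).
  apply: le_trans h; rewrite ler_nat; apply: subset_leq_card; apply/subsetP => f.
  rewrite !inE => /andP[-> fS] /=; apply: subset_trans fS.
  by rewrite -QS; apply: imsetS.
apply: ler_wpM2r => //; rewrite cQ.
have [dl dlE dlb] : exists2 dl, #|Q| = (#|Q'| + dl)%N & (dl <= 2 ^ (2 * m))%N.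
  exists #|[set e in Q | ~~ uncut m x e]|; last exact: card_cut QC.
  rewrite -(cardsID Q' Q); congr (_ + _)%N; first by move/setIidPr: Q'Q => ->.
  apply: eq_card => e; rewrite in_setD [e \in Q']inE [RHS]inE.
  by case: (e \in Q); case: (uncut _ _ _).
clearbody q0; rewrite exprMn dlE [X in _ <= _ * X]exprD -dlE mulrCA ler_peMr ?exprn_ge0 ?(ltW q0p) //.
apply: (@le_trans _ _ (2 ^+ #|Q| * n%:R^-1 ^+ dl)); last first.
  by apply: ler_wpM2l; rewrite ?exprn_ge0 //; apply: lerXn2r; rewrite ?nnegrE ?invr_ge0 ?(ltW q0p).
rewrite exprVn ler_pdivlMr ?exprn_gt0 // mul1r -!natrX ler_nat.
apply: (@leq_trans (n ^ (2 ^ (2 * m)))); first by rewrite leq_pexp2l.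
rewrite -(@leq_exp2r _ _ m) ?(leq_trans _ k_lt_m) //.
by rewrite -!expnM; apply: (leq_trans nbig); rewrite leq_pexp2l.
Qed.

End CyclicSpread.

(** * The random hypergraph at fixed n *)

Section RandomHypergraph.
Variables (R : realType) (n' k : nat).
Local Notation n := n'.+1.
Local Notation V := 'I_n.

Lemma Gkp_probE (p : R) (A : pred {set {set V}}) :
  Gkp_prob k p A =
  \sum_(G : {set {set V}}) perc_weight [set e : {set V} | #|e| == k] p G * (A G)%:R.
Proof.
rewrite /Gkp_prob big_mkcond /=; apply: eq_bigr => G _.
case: (boolP (is_kgraph k G)) => [/forallP Gk|Gk] /=; last first.
  have [e /andP[eG ek]] : exists e, (e \in G) && (#|e| != k).
    by move: Gk; rewrite negb_forall => /existsP[e]; rewrite negb_imply; exists e.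
  by rewrite /perc_weight (bigD1 e) //= eG inE (negPf ek) !mul0r.
case: (A G); rewrite ?mulr0 // mulr1 /Gkp_weight /perc_weight big_mkcond /=.
apply: eq_bigr => e _; rewrite inE; case: ifP => // ek; case: ifP => // eG.
by have := Gk e; rewrite eG ek.
Qed.

Lemma Gkp_prob_le1 (p : R) (A : pred {set {set V}}) : 0 <= p <= 1 ->
  Gkp_prob k p A <= 1.
Proof.
move=> p01; rewrite Gkp_probE -[X in _ <= X](sum_perc_weight [set e : {set V} | #|e| == k] p).
by apply: ler_sum => G _; rewrite ler_piMr ?perc_weight_ge0 // lern1 leq_b1.
Qed.

Lemma ham_power_of_perm (m t r : nat) (H G : {set {set V}}) (blk : 'I_t -> 'I_k -> V)
    (f : {perm V}) : m = (k + r - 1)%N -> (m <= n)%N ->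
  f \in block_perms H blk [set: 'I_t] -> power_edges m blk f \subset G ->
  has_tight_ham_cycle_power k r (H :|: G).
Proof.
move=> mE mn /block_permsP fH fG.
pose g := [ffun i : 'I_#|V| => f (cast_ord (card_ord n) i)].
apply/existsP; exists [set e : {set V} | (#|e| == k) &&
   [exists i : 'I_#|V|, e \subset g @: cyc_window (k + r - 1) i]].
apply/andP; split.
  apply/existsP; exists g; rewrite eqxx andbT; apply/injectiveP => i j.
  by rewrite !ffunE => /perm_inj /cast_ord_inj.
apply/subsetP => e; rewrite inE => /andP[ek /existsP[i ei]].
pose i' := cast_ord (card_ord n) i.
have gw : g @: cyc_window (k + r - 1) i \subset f @: arc m i'.
  apply/subsetP => v /imsetP[a aw ->]; rewrite ffunE; apply: imset_f.
  rewrite -cyc_windowE // mE; move: aw; rewrite !inE => /existsP[j /eqP aj].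
  by apply/existsP; exists j; rewrite /= aj; move: (nat_of_ord i) => z; rewrite card_ord.
pose c := f @^-1: e.
have ec : e = f @: c.
  apply/setP => v; apply/idP/imsetP => [ve|[u]]; last by rewrite inE => ue ->.
  by exists ((f^-1)%g v); rewrite ?inE permKV.
have cT : c \in tight_edges n' k m.
  rewrite inE -(card_imset _ (@perm_inj _ f)) -ec ek /=.
  apply/existsP; exists i'; apply/subsetP => u; rewrite inE => ue.
  by have /imsetP[u' u'a /perm_inj ->] := subsetP (subset_trans ei gw) _ ue.
rewrite inE; case: (boolP (c \in [set block blk j | j : 'I_t])) => [/imsetP[j _ cj]|cb].
  by rewrite ec cj fH ?inE.
apply/orP; right; apply: (subsetP fG); rewrite ec; apply: imset_f.
by rewrite inE cb.
Qed.

End RandomHypergraph.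

(** * Equally spaced blocks *)

Section RegularBlocks.
Variables (n' k L : nat).
Local Notation n := n'.+1.
Local Notation V := 'I_n.
Hypothesis kL : (k <= L)%N.
Hypothesis k0 : (0 < k)%N.
Hypothesis Ln : (L <= n)%N.
Local Notation t := (n %/ L)%N.

Definition reg_start (j : 'I_t) : V := inord (j * L).
Definition reg_blk (j : 'I_t) (i : 'I_k) : V := inord (j * L + i).

Let reg_lt (j : 'I_t) i : (i < L)%N -> (j * L + i < n)%N.
Proof.
move=> iL; apply: (@leq_trans (j.+1 * L)); first by rewrite mulSn addnC ltn_add2r.
apply: (@leq_trans (t * L)); last exact: leq_trunc_div.
by rewrite leq_mul2r ltn_ord orbT.
Qed.

Lemma reg_blkE j i : reg_blk j i = (j * L + i)%N :> nat.
Proof. by rewrite inordK // reg_lt // (leq_trans (ltn_ord i)). Qed.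

Lemma reg_startE j : reg_start j = (j * L)%N :> nat.
Proof. by rewrite inordK // -[X in (X < _)%N]addn0 reg_lt // (leq_trans k0). Qed.

Lemma reg_blk_inj j i j' i' : reg_blk j i = reg_blk j' i' -> j = j' /\ i = i'.
Proof.
move=> /(congr1 (@nat_of_ord _)); rewrite !reg_blkE => e.
have iL := leq_trans (ltn_ord i) kL; have i'L := leq_trans (ltn_ord i') kL.
have L0 : (0 < L)%N by exact: leq_trans iL.
have := congr1 (divn^~ L) e; rewrite !divnMDl // (divn_small iL) (divn_small i'L) !addn0 => jj.
split; first exact: val_inj.
by apply: val_inj; move: e; rewrite jj => /addnI.
Qed.

Lemma reg_block_arc j : block reg_blk j = arc k (reg_start j).
Proof.
apply/setP => v; rewrite inE val_subr reg_startE; apply/imsetP/idP => [[i _ ->]|].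
  by rewrite reg_blkE leq_addr addKn.
have lt1 : (j * L + L <= n)%N.
  have := @reg_lt j L.-1; have := ltn_ord j; have L0 : (0 < L)%N by exact: leq_trans kL.
  by rewrite prednK //; lia.
case: ifP => hv h; last first.
  by move: hv h; clear -kL lt1; lia.
exists (Ordinal h) => //; apply: val_inj.
by rewrite /= reg_blkE /= subnKC.
Qed.

(** The remainder of [n] modulo [L] lengthens the gap after the last start, hence [2 * L]. *)
Lemma reg_dense (b : V) : exists j, (val (reg_start j - b)%R < 2 * L)%N.
Proof.
have L0 : (0 < L)%N by exact: leq_trans kL.
have t0 : (0 < t)%N by rewrite divn_gt0.
have lb := ltn_ord b; have nt := ltn_ceil n L0.
pose c := ((b + L.-1) %/ L)%N.
have c1 : (c * L <= b + L.-1)%N by exact: leq_trunc_div.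
have c2 : (b + L.-1 < c.+1 * L)%N by exact: ltn_ceil.
have [ct|ct] := ltnP c t.
  exists (Ordinal ct); rewrite val_subr reg_startE /=.
  move: c1 c2 L0; clear; rewrite mulSn; move: (c * L)%N (b : nat) => x y.
  by case: ifP; lia.
exists (Ordinal t0); rewrite val_subr reg_startE /= mul0n.
have h : (t * L <= c * L)%N by rewrite leq_mul2r ct orbT.
move: h nt c1 lb L0; clear; rewrite mulSn; move: (t * L)%N (c * L)%N (b : nat) => x y z.
by case: ifP; lia.
Qed.

End RegularBlocks.

Lemma expn_le_exp2n (C N : nat) : (0 < C)%N -> (C * (2 * C + 1) <= N)%N -> (N ^ C <= 2 ^ N)%N.
Proof.
move=> C0 CN; set s := (N %/ C)%N.
have sC : (2 * C + 1 <= s)%N by rewrite leq_divRL // mulnC.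
have Ns : (N < s.+1 * C)%N by exact: ltn_ceil.
have h : (N <= 2 ^ s)%N.
  apply: (leq_trans (ltnW Ns)); rewrite -(subnK (_ : C <= s)%N); last by lia.
  set x := (s - C)%N; have xC : (C + 1 <= x)%N by rewrite /x; lia.
  rewrite expnD; apply: leq_mul; last by rewrite ltnW // ltn_expl.
  have := ltn_expl x.-1 (isT : 1 < 2)%N; have x0 : (0 < x)%N by lia.
  have -> : (2 ^ x = 2 * 2 ^ x.-1)%N by rewrite -expnS prednK.
  by move: (2 ^ x.-1)%N xC x0 => y; clearbody x; clear; lia.
apply: (@leq_trans ((2 ^ s) ^ C)); first by rewrite leq_exp2r.
by rewrite -expnM leq_exp2l // leq_trunc_div.
Qed.

(** [2 * k ^ 2 <= L] keeps the blocks on at most half of the positions. [2 * k ^ 2 <= L * eps]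
    bounds the tuples that hit the image of the blocks by half of [eps * n ^ k], so the count [c] of
    usable edge maps satisfies [n ^ k <= K * c]. *)
Lemma ham_power_prob (R : realType) (n' k r L J : nat) (H : {set {set 'I_n'.+1}})
    (eps K p th w : R) :
  let n := n'.+1 in let m := (k + r - 1)%N in
  let M := (m * (2 * L + k))%N in
  let q := 2 * (((2 * m)%:R * K) ^+ k * w ^+ M) in
  (2 <= k)%N -> (2 <= r)%N -> is_kgraph k H -> eps * n%:R ^+ k <= #|H|%:R ->
  (2 * k ^ 2 <= L)%N -> (2 * k ^ 2)%:R <= L%:R * eps -> 0 < eps ->
  (L <= n)%N -> (m <= n)%N -> (n ^ (2 ^ (2 * m) * m) <= 2 ^ n)%N ->
  1 <= K -> 2 * expR 1 <= K -> 2 <= K * eps ->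
  0 < w <= 1 -> w ^+ (M * 'C(k + r - 2, k - 1) - 1) = n%:R^-1 ->
  (2 <= J)%N -> 0 < p <= 1 -> 0 < th -> th ^+ J * (n * 2 ^ m)%:R < 1 ->
  expR 1 * q <= th * (p / J%:R) ->
  1 - J%:R * (expR 1 * q / (th * (p / J%:R))) <=
  Gkp_prob k p (fun G : {set {set 'I_n}} => has_tight_ham_cycle_power k r (H :|: G)).
Proof.
move=> n m M q k2 r2 Hk He L1 L2 eps0 Ln mn nbig K1 Ke Keps w01 wn J2 /andP[p0 p1].
move=> th0 thJ hq.
have k0 : (0 < k)%N by exact: leq_trans k2.
have kk : (k <= k ^ 2)%N by rewrite -[X in (X <= _)%N]expn1 leq_pexp2l.
have kL : (k <= L)%N by apply: leq_trans L1; rewrite (leq_trans kk) // leq_pmull.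
have L0 : (0 < L)%N by exact: leq_trans kL.
have km : (k < m)%N by rewrite /m; clear -r2 k0; lia.
have n0 : 0 < n%:R :> R by rewrite ltr0n.
have K0 : 0 < K by apply: lt_le_trans K1.
pose t := (n %/ L)%N; pose blk := @reg_blk n' k L.
have tL : (t * L <= n)%N by exact: leq_trunc_div.
have H_k e : e \in H -> #|e| = k.
  by move=> eH; have := forallP Hk e; rewrite eH => /eqP.
have blkI := @reg_blk_inj n' k L kL.
pose c := (#|H| - k * (t * k * n ^ (k - 1)))%N.
have hc (U : {set 'I_n}) : (#|U| <= t * k)%N -> (c <= #|edge_maps k H U|)%N.
  move=> Ut; rewrite leq_subLR addnC; apply: (leq_trans (card_edge_maps H_k U)).
  by rewrite card_ord leq_add2l leq_mul2l leq_mul2r Ut !orbT.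
have lost : (2 * k ^ 2)%:R * (t * n ^ (k - 1))%:R <= eps * n%:R ^+ k.
  apply: (le_trans (ler_wpM2r _ L2)) => //.
  rewrite [L%:R * eps]mulrC -mulrA; apply: ler_wpM2l; first exact: ltW.
  rewrite -natrM -natrX ler_nat mulnA [(L * t)%N]mulnC.
  apply: (@leq_trans (n * n ^ (k - 1))); first by rewrite leq_mul2r tL orbT.
  by rewrite -expnS subn1 prednK.
have cE : eps * n%:R ^+ k <= 2 * c%:R.
  have : #|H|%:R <= c%:R + (k * (t * k * n ^ (k - 1)))%:R :> R.
    by rewrite -natrD ler_nat addnC -leq_subLR.
  have -> : (k * (t * k * n ^ (k - 1)))%N = (k ^ 2 * (t * n ^ (k - 1)))%N.
    by rewrite mulnA [(k * (t * k))%N]mulnCA -mulnA mulnCA mulnA mulnn -mulnA.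
  rewrite natrM; move: lost; rewrite (natrM _ 2) -mulrA.
  by move: He; set a := eps * _; set b := (k ^ 2)%:R * _ => ? ? ?; lra.
have Kc : n%:R ^+ k <= K * c%:R.
  have nk : 0 <= n%:R ^+ k :> R by rewrite exprn_ge0.
  have h1 := ler_wpM2r nk Keps.
  have h2 := ler_wpM2l (ltW K0) cE.
  by move: h1 h2; rewrite mulrA [K * (2 * _)]mulrCA; lra.
have tk : (t * k * 2 <= n)%N.
  apply: leq_trans tL; rewrite -mulnA leq_mul2l; apply/orP; right.
  apply: leq_trans L1; by rewrite mulnC leq_mul2l kk.
have Kspr A g : #|agree H blk A g|%:R <=
    (K / n%:R) ^+ #|A| * #|block_perms H blk [set: 'I_t]|%:R.
  have := @agree_spread R 'I_n k t H blk c K A g blkI hc.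
  rewrite card_ord; apply => //.
  have := cardsC (blockset blk); rewrite card_ord.
  have := card_blockset blk; move: tk; clear.
  by move: (t * k)%N #|blockset blk| #|~: blockset blk| => x y z; lia.
have dE : 'C(m - 1, k - 1) = 'C(k + r - 2, k - 1) by rewrite /m -subnDA.
have spr := spread_cyclic k2 km mn (@reg_block_arc n' k L kL k0 Ln)
  (@reg_dense n' k L kL k0 Ln) Kspr K1 w01.
have {}spr := spr (etrans (congr1 (fun d => w ^+ (M * d - 1)) dE) wn).
have {}spr : forall S : {set {set 'I_n}},
   #|[set f in block_perms H blk [set: 'I_t] | S \subset power_edges m blk f]|%:R
    <= q ^+ #|S| * #|block_perms H blk [set: 'I_t]|%:R.
  by apply: spr => //; rewrite muln_gt0.
set Om := block_perms H blk [set: 'I_t] in spr.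
have c0 : (0 < c)%N.
  rewrite -(ltr_nat R) -(pmulr_rgt0 _ (ltr0n R 2)).
  by apply: lt_le_trans cE; rewrite mulr_gt0 // exprn_gt0.
have Om0 : 0 < #|Om|%:R :> R.
  rewrite ltr0n card_gt0; apply: block_perms_neq0 => // U Ut.
  by rewrite -card_gt0; exact: leq_trans (hc U Ut).
have J0 : 0 < J%:R :> R by rewrite ltr0n; exact: leq_trans J2.
have pJ0 : 0 < p / J%:R by rewrite divr_gt0.
have pJ1 : p / J%:R < 1.
  rewrite ltr_pdivrMr // mul1r; apply: (le_lt_trans p1).
  by rewrite (ltr_nat R 1 J).
have q0 : 0 < q.
  have /andP[w0 _] := w01; rewrite !mulr_gt0 // exprn_gt0 // mulr_gt0 //.
  by rewrite ltr0n muln_gt0 /=; exact: leq_ltn_trans km.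
pose D := [set e : {set 'I_n} | #|e| == k].
have PD f : f \in Om -> power_edges m blk f \subset D.
  move=> _; apply/subsetP => s /imsetP[e]; rewrite !inE => /andP[_ /andP[ek _]] ->.
  by rewrite card_imset //; exact: perm_inj.
have Pb f : f \in Om -> #|power_edges m blk f|%:R <= (n * 2 ^ m)%:R :> R.
  move=> _; rewrite ler_nat; apply: leq_trans (card_tight_edges n' k m).
  apply: (leq_trans (leq_imset_card _ _)); apply: subset_leq_card.
  exact: subsetDl.
(* Bernoulli's inequality: [J] rounds of density [p / J] fit into one exposure of density [p]. *)
have bern : 1 - p <= (1 - p / J%:R) ^+ J.
  have h (s : nat) : 1 - s%:R * (p / J%:R) <= (1 - p / J%:R) ^+ s.
    elim: s => [|s IH]; first by rewrite mul0r subr0 expr0.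
    have x0 : 0 <= 1 - p / J%:R by rewrite subr_ge0 ltW.
    rewrite exprS; apply: le_trans (ler_wpM2l x0 IH); rewrite -natr1.
    move: (p / J%:R) pJ0 => x xp; have s0 : 0 <= s%:R :> R by [].
    by have : 0 <= s%:R * x * x; [rewrite !mulr_ge0 // ltW | nra].
  by have := h J; rewrite mulrCA mulfV ?mulr1 // gt_eqF.
have := @spread_cover_fail R _ _ D (p / J%:R) th q #|Om|%:R J
   (power_edges m blk) Om (n * 2 ^ m)%:R p.
rewrite pJ0 pJ1 => /(_ isT th0 q0 hq (ltW Om0) (ler0n _ _) thJ).
rewrite (ltW p0) p1 => /(_ isT bern PD Pb spr).
rewrite [_ * #|Om|%:R]mulrC ler_pM2l // => hfail.
apply: (@le_trans _ _ (1 - \sum_(W : {set {set 'I_n}}) perc_weight D p W *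
    (~~ [exists f in Om, power_edges m blk f \subset W])%:R)).
  by rewrite lerD2l lerN2.
rewrite Gkp_probE -/D -[X in X - _](sum_perc_weight D p) -sumrB; apply: ler_sum => W _.
rewrite -{1}[perc_weight D p W]mulr1 -mulrBr; apply: ler_wpM2l.
  by apply: perc_weight_ge0; rewrite (ltW p0).
case: (boolP [exists f in Om, _]) => [/existsP[f /andP[fO fW]]|_] /=.
  by rewrite (ham_power_of_perm (erefl : m = (k + r - 1)%N) mn fO fW) subr0.
by rewrite subrr.
Qed.

(** * Asymptotics *)

Local Open Scope classical_set_scope.

Lemma near_powRN_le (R : realType) (a e : R) : 0 < a -> 0 < e ->
  \forall n \near \oo, n%:R `^ (- a) <= e.
Proof.
move=> a0 e0; near=> n.
have hn : e^-1 `^ a^-1 <= n%:R by near: n; exact: nbhs_infty_ger.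
have e1 : 0 < e^-1 `^ a^-1 by rewrite powR_gt0 // invr_gt0.
have n0 : 0 < n%:R :> R by exact: lt_le_trans hn.
rewrite powRN invf_ple ?posrE ?powR_gt0 //.
have -> : e^-1 = (e^-1 `^ a^-1) `^ a.
  by rewrite -powRrM mulVf ?gt_eqF // powRr1 // invr_ge0 ltW.
by apply: ge0_ler_powR => //; rewrite ?nnegrE; exact: ltW.
Unshelve. all: by end_near.
Qed.

(* [w] is n^(-1/(Md-1)), [th] is n^(-a/4), and M/(Md-1) = 1/d + a. *)
Lemma power_bounds (R : realType) (n d M J c : nat) (a p Kq : R) :
  let w := n%:R `^ (- ((M * d - 1)%:R)^-1) in
  let th := n%:R `^ (- (a / 4)) in
  (0 < n)%N -> (0 < d)%N -> (1 < M * d)%N -> a = (d%:R * (M * d - 1)%:R)^-1 ->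
  (0 < J)%N -> 8 <= J%:R * a -> (c < n)%N -> 0 <= Kq ->
  n%:R `^ (- (d%:R)^-1 - a / 2) <= p ->
  [/\ 0 < w <= 1, w ^+ (M * d - 1) = n%:R^-1, 0 < th, th ^+ J * (n * c)%:R < 1 &
   expR 1 * (Kq * w ^+ M) <= expR 1 * Kq * J%:R * th * (th * (p / J%:R))].
Proof.
move=> w th n0 d0 Md aE J0 Ja cn Kq0 hp; set D := (M * d - 1)%N in w aE *.
have x1 : 1 <= n%:R :> R by rewrite ler1n.
have x0 : 0 < n%:R :> R by rewrite ltr0n.
have D0 : 0 < D%:R :> R by rewrite ltr0n subn_gt0.
have d0' : 0 < d%:R :> R by rewrite ltr0n.
have J0' : 0 < J%:R :> R by rewrite ltr0n.
have a0 : 0 < a by rewrite aE invr_gt0 mulr_gt0.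
have ME : M%:R / D%:R = d%:R^-1 + a.
  have : M%:R * d%:R = D%:R + 1 :> R by rewrite -natrM natr1 /D subn1 prednK // ltnW.
  rewrite aE => h; have -> : M%:R = (D%:R + 1) / d%:R :> R by rewrite -h mulfK // gt_eqF.
  by field; rewrite !gt_eqF.
(* Half of the gain [a] goes to [eta], the rest to two factors [th]: one pays for the shrinking of
   fragments, the other makes the failure probability vanish. *)
have wM : w ^+ M = n%:R `^ (- d%:R^-1 - a / 2) * th * th.
  have nz b : (b == 0) ==> (n%:R != 0 :> R) by apply/implyP => _; rewrite gt_eqF.
  rewrite -powR_mulrn ?powR_ge0 // -powRrM -!powRD ?nz //; congr (_ `^ _).
  rewrite mulNr mulrC ME; clear; lra.
split.
- apply/andP; split; first exact: powR_gt0.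
  rewrite -[X in _ <= X](powRr0 n%:R) /w; exact: ler_powR.
- rewrite -powR_mulrn ?powR_ge0 // -powRrM mulNr mulVf ?gt_eqF //.
  by rewrite powR_inv1 // ltW.
- exact: powR_gt0.
- apply: (@le_lt_trans _ _ (n%:R `^ (- 2%:R) * (n * c)%:R)).
    apply: ler_wpM2r => //; rewrite -powR_mulrn ?powR_ge0 // -powRrM ler_powR //.
    by clear -Ja; lra.
  rewrite powR_invn ?(ltW x0) // mulrC ltr_pdivrMr ?exprn_gt0 // mul1r expr2 natrM.
  by rewrite ltr_pM2l // ltr_nat.
have th0 : 0 < th by exact: powR_gt0.
rewrite wM; set u := _ `^ _ in hp *.
have -> : expR 1 * Kq * J%:R * th * (th * (p / J%:R)) = expR 1 * (Kq * (p * th * th)).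
  by field; rewrite gt_eqF.
apply: ler_wpM2l; first exact: expR_ge0.
by apply: ler_wpM2l => //; rewrite !(ler_pM2r th0).
Qed.

Theorem theorem1p8 (R : realType) (k r : nat) (hk : (2 <= k)%N)
    (hr : (2 <= r)%N) (eps : R) (heps : 0 < eps) :
  exists2 eta : R, 0 < eta &
    forall (p : nat -> R) (H : forall n : nat, {set {set 'I_n}}),
      (forall n : nat, 0 <= p n <= 1) ->
      (\forall n \near \oo,
         n%:R `^ (- ('C(k + r - 2, k - 1)%:R)^-1 - eta) <= p n) ->
      (forall n : nat, is_kgraph k (H n)) ->
      (\forall n \near \oo, eps * n%:R ^+ k <= #|H n|%:R) ->
      Gkp_prob k (p n)
        (fun G : {set {set 'I_n}} =>
           has_tight_ham_cycle_power k r (H n :|: G)) @[n --> \oo] --> (1 : R).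
Proof.
pose d := 'C(k + r - 2, k - 1); pose m := (k + r - 1)%N.
pose L := (2 * k ^ 2 + Num.bound ((2 * k ^ 2)%:R / eps))%N.
pose M := (m * (2 * L + k))%N.
have d0 : (0 < d)%N by rewrite bin_gt0; lia.
have k20 : (0 < 2 * k ^ 2)%N by rewrite muln_gt0 expn_gt0; lia.
have L0 : (0 < L)%N by rewrite addn_gt0 k20.
have L2 : (2 * k ^ 2)%:R <= L%:R * eps.
  rewrite -ler_pdivrMr // /L natrD; apply: ler_wpDl => //.
  by apply/ltW/archi_boundP; rewrite divr_ge0 // ltW.
have Md : (1 < M * d)%N.
  have m2 : (1 < m)%N by rewrite /m; clear -hk hr; lia.
  have l1 : (0 < 2 * L + k)%N by rewrite addn_gt0 muln_gt0 L0.
  by rewrite /M -mulnA; apply: (leq_trans m2); rewrite leq_pmulr // muln_gt0 l1.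
pose a : R := (d%:R * (M * d - 1)%:R)^-1.
have a0 : 0 < a by rewrite invr_gt0 mulr_gt0 ?ltr0n // subn_gt0.
(* [8 <= J * a] gives [th ^+ J <= n ^ -2], which beats the bound [n * 2 ^ m] on the number of edges
   once [n > 2 ^ m]. *)
pose J := (2 + Num.bound (8 / a))%N.
have Ja : 8 <= J%:R * a.
  rewrite -ler_pdivrMr // /J natrD; apply: ler_wpDl => //.
  by apply/ltW/archi_boundP; rewrite divr_ge0 // ltW.
pose K : R := 2 / eps + 2 * expR 1 + 1.
have e0 := expR_ge0 (1 : R).
have iv0 : 0 <= 2 / eps by rewrite divr_ge0 // ltW.
have K1 : 1 <= K by rewrite /K; move: iv0 e0; clear; lra.
have Ke : 2 * expR 1 <= K by rewrite /K; move: iv0 e0; clear; lra.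
have Keps : 2 <= K * eps.
  by rewrite -ler_pdivrMr // /K; move: iv0 e0; clear; lra.
pose Kq : R := 2 * ((2 * m)%:R * K) ^+ k.
have Kq0 : 0 <= Kq.
  by rewrite mulr_ge0 // exprn_ge0 // mulr_ge0 // (le_trans ler01 K1).
pose cst := expR 1 * Kq * J%:R.
have cst0 : 0 <= cst by do 2![apply: mulr_ge0 => //].
pose C := (2 ^ (2 * m) * m)%N.
pose N0 := (C * (2 * C + 1) + 2 ^ m + L + m).+1.
have C0 : (0 < C)%N by rewrite muln_gt0 expn_gt0 /m /=; clear -hk hr; lia.
(* [a] depends on [eps] through the block spacing [L]: a sparser [H] forces rarer blocks and a
   smaller gain. *)
exists (a / 2); first by rewrite divr_gt0.
move=> p H p01 hp Hk hH.
have key (n : nat) (e : R) : (N0 <= n)%N ->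
    n%:R `^ (- (d%:R)^-1 - a / 2) <= p n -> eps * n%:R ^+ k <= #|H n|%:R ->
    n%:R `^ (- (a / 4)) <= (cst + 1)^-1 -> n%:R `^ (- (a / 4)) <= e / (J%:R * cst + 1) ->
    0 < e ->
    `|1 - Gkp_prob k (p n) (fun G : {set {set 'I_n}} =>
           has_tight_ham_cycle_power k r (H n :|: G))| <= e.
  case: n => [//|n'] nN pn Hn y1 y2 epos.
  have cn : (2 ^ m < n'.+1)%N.
    by move: nN; rewrite /N0; move: (C * _)%N (2 ^ m)%N => x z; clear; lia.
  have [w01 wn th0 thJ hq] :=
    @power_bounds R n'.+1 d M J (2 ^ m) a (p n'.+1) Kq isT d0 Md erefl isT Ja cn Kq0 pn.
  set th := _ `^ _ in y1 y2 th0 thJ hq.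
  set w := _ `^ _ in w01 wn hq.
  have p0 : 0 < p n'.+1 by apply: lt_le_trans pn; rewrite powR_gt0 // ltr0n.
  have /andP[_ p1] := p01 n'.+1.
  have J0 : 0 < J%:R :> R by rewrite ltr0n.
  have thp : 0 < th * (p n'.+1 / J%:R) by rewrite mulr_gt0 // divr_gt0.
  (* Secures the premise on [q] in [ham_power_prob]; the next bound controls the total failure
     probability. *)
  have cth : cst * th <= 1.
    have h : 0 < cst + 1 by rewrite ltr_wpDl.
    move: y1; rewrite -[(cst + 1)^-1]mul1r ler_pdivlMr //.
    by move: th0; clear; move: cst th => x z; lra.
  have Jth : J%:R * (cst * th) <= e.
    have h : 0 < J%:R * cst + 1 by rewrite ltr_wpDl // mulr_ge0.
    move: y2; rewrite ler_pdivlMr // mulrA.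
    by move: th0; clear; move: (J%:R * cst) th => x z; lra.
  have KqE : 2 * (((2 * m)%:R * K) ^+ k * w ^+ M) = Kq * w ^+ M by rewrite mulrA.
  have hP : 1 - J%:R * (expR 1 * (Kq * w ^+ M) / (th * (p n'.+1 / J%:R))) <=
     Gkp_prob k (p n'.+1) (fun G : {set {set 'I_n'.+1}} =>
           has_tight_ham_cycle_power k r (H n'.+1 :|: G)).
    rewrite -KqE; apply: (@ham_power_prob R n' k r L J (H n'.+1) eps K) => //.
    - exact: leq_addr.
    - by move: nN; rewrite /N0; move: (C * _)%N (2 ^ m)%N => x z; clear; lia.
    - rewrite -/m; move: nN; rewrite /N0.
      by move: (C * _)%N (2 ^ m)%N => x z; clearbody m L; clear; lia.
    - apply: expn_le_exp2n => //; rewrite -/m -/C; move: nN; rewrite /N0.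
      by move: (C * _)%N (2 ^ m)%N => x z; clearbody m L; clear; lia.
    - by rewrite p0.
    - rewrite -/m -/M KqE; apply: (le_trans hq).
      by rewrite -/cst ler_piMl // ltW.
  have P1 := @Gkp_prob_le1 R n' k (p n'.+1) (fun G : {set {set 'I_n'.+1}} =>
           has_tight_ham_cycle_power k r (H n'.+1 :|: G)) (p01 n'.+1).
  rewrite ger0_norm ?subr_ge0 // lerBlDr -lerBlDl; apply: le_trans hP.
  rewrite lerD2l lerN2; apply: le_trans Jth; apply: ler_wpM2l => //.
  by rewrite ler_pdivrMr.
apply/cvgrPdist_le => e epos; near=> n; apply: key => //; near: n.
- exact: nbhs_infty_ge.
- exact: hp.
- exact: hH.
- by apply: near_powRN_le; rewrite ?divr_gt0 // invr_gt0 ltr_wpDl.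
- by apply: near_powRN_le; rewrite ?divr_gt0 // ltr_wpDl // mulr_ge0.
Unshelve. all: by end_near.
Qed.
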